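(* For every $\alpha\in[0,1)$ there is a constant $c_\alpha$, depending only on $\alpha$, such that for any finite group $G$, any $f=f^*\in\mathbb{C}[G]$ with $1_G\succeq f\succeq\alpha1_G$, and any positive integer $d$, $$\delta_d\le\begin{cases}\dfrac{c_\alpha}{\sqrt{2d-1}}\left(\dfrac{1-\alpha^2}{1+\alpha^2}\right)^{d}\beta_{f,G} & \text{if }0<\alpha<1,\\[2mm]\dfrac{c_0}{d}\,\beta_{f,G} & \text{if }\alpha=0,\end{cases}$$ where, for the given $d$, $$\beta_{f,G}:=\min\Big\{2\|C_{\sqrt f}\|_1\,(|G|-|S_d|),\ 3\,|\operatorname{supp}(f)|^{d}\Big\}$$ and $$\delta_d:=\min\big\{\lambda\ge0:\ f+\lambda1_G=f_Q\ \text{for some } Q\in\mathbb{C}^{S_d\times S_d},\ Q=Q^{\mathsf H},\ Q\succeq0\big\}.$$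
   Context: For a finite group $G$ with identity $1_G$, every $f\in\mathbb{C}[G]$ is written $f=\sum_{x\in G}C_f(x)x$ with $C_f:G\to\mathbb{C}$; $f^*=\sum_{x}\overline{C_f(x)}x^{-1}$; $\operatorname{supp}(f)=\{x\in G:C_f(x)\ne0\}$; $\|C_f\|_1=\sum_{x\in G}|C_f(x)|$. A $*$-representation of $\mathbb{C}[G]$ is an algebra homomorphism $\pi:\mathbb{C}[G]\to\mathbb{C}^{n\times n}$ with $\pi(x)$ unitary for $x\in G$ and $\pi(f^* )=\pi(f)^{\mathsf H}$ (conjugate transpose). The notation $1_G\succeq f\succeq\alpha1_G$ means that, for every $*$-representation $\pi$, all eigenvalues of the Hermitian matrix $\pi(f)$ lie in $[\alpha,1]$. An element is nonnegative if its image under every $*$-representation is positive semidefinite; for nonnegative $f$, $\sqrt f$ denotes the unique nonnegative $h\in\mathbb{C}[G]$ with $h=h^*$ and $h^2=f$. For $k\ge 0$ let $p_{\alpha,k}$ be the real univariate polynomial of degree at most $k$ that is the best uniform approximation of $\sqrt t$ on $[\alpha,1]$, i.e. the minimizer of $\max_{t\in[\alpha,1]}|p(t)-\sqrt t|$ over real polynomials $p$ of degree at most $k$. For $f=f^*\in\mathbb{C}[G]$ with $1_G\succeq f\succeq\alpha1_G$, $p_{\alpha,k}(f)\in\mathbb{C}[G]$ is obtained by evaluating the polynomial at $f$ (the constant term being multiplied by $1_G$), and $S_d:=\bigcup_{0\le k\le d}\operatorname{supp}(p_{\alpha,k}(f))\subseteq G$. For $Q\in\mathbb{C}^{S_d\times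 S_d}$ (a matrix with rows and columns indexed by $S_d$), $f_Q:=\sum_{x,y\in S_d}Q(x,y)\,x^{-1}y\in\mathbb{C}[G]$. *)

(* Defs.v *)
From HB Require Import structures.
From mathcomp Require Import all_boot all_order all_fingroup all_algebra.
From mathcomp Require Import complex.
From mathcomp Require Import all_classical all_reals.

Set Implicit Arguments.
Unset Strict Implicit.
Unset Printing Implicit Defensive.

Import Order.TTheory GRing.Theory Num.Theory.
Local Open Scope ring_scope.
Local Open Scope complex_scope.
Local Open Scope sesquilinear_scope.
Local Open Scope classical_set_scope.

Section GroupAlgebra.
Variables (K : comNzRingType) (gT : finGroupType).

(* The function [f : {ffun gT -> K}] stands for [\sum_x f x *: x].  An alias is
   needed because [{ffun gT -> K}] already carries the pointwise product. *)
Definition galg : Type := {ffun gT -> K^o}.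

HB.instance Definition _ := GRing.Lmodule.copy galg {ffun gT -> K^o}.

Definition gcoef (f : galg) (x : gT) : K := (f : {ffun gT -> K^o}) x.

Definition gelt (x : gT) : galg := [ffun y => (y == x)%:R].

Definition gmul (f g : galg) : galg :=
  [ffun x => \sum_y gcoef f y * gcoef g (y^-1 * x)%g].

Lemma gcoefP (f g : galg) : gcoef f =1 gcoef g -> f = g.
Proof. by move=> fg; apply/ffunP. Qed.

Lemma gcoefD f g x : gcoef (f + g) x = gcoef f x + gcoef g x.
Proof. by rewrite /gcoef ffunE. Qed.

Lemma gcoefZ (a : K) f x : gcoef (a *: f) x = a * gcoef f x.
Proof. by rewrite /gcoef ffunE. Qed.

Lemma gcoef_gelt x y : gcoef (gelt x) y = (y == x)%:R.
Proof. by rewrite /gcoef ffunE. Qed.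

Lemma gcoef_gmul f g x :
  gcoef (gmul f g) x = \sum_y gcoef f y * gcoef g (y^-1 * x)%g.
Proof. by rewrite /gcoef ffunE. Qed.

Fact gmulA : associative gmul.
Proof.
move=> f g h; apply: gcoefP => x; rewrite !gcoef_gmul.
under eq_bigr do rewrite gcoef_gmul big_distrr /=.
under [RHS]eq_bigr do rewrite gcoef_gmul big_distrl /=.
rewrite [RHS]exchange_big /=; apply: eq_bigr => y _.
rewrite (reindex_inj (mulgI y^-1%g)) /=; apply: eq_bigr => z _.
by rewrite mulrA invMg invgK -mulgA mulKVg.
Qed.

Fact gmul1g : left_id (gelt 1%g) gmul.
Proof.
move=> f; apply: gcoefP => x; rewrite gcoef_gmul (bigD1 1%g) //=.
rewrite gcoef_gelt eqxx mul1r invg1 mul1g big1 ?addr0 // => y /negPf y1.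
by rewrite gcoef_gelt y1 mul0r.
Qed.

Fact gmulg1 : right_id (gelt 1%g) gmul.
Proof.
move=> f; apply: gcoefP => x; rewrite gcoef_gmul (bigD1 x) //=.
rewrite gcoef_gelt mulVg eqxx mulr1 big1 ?addr0 // => y yx.
by rewrite gcoef_gelt -eq_mulVg1 (negPf yx) mulr0.
Qed.

Fact gmulDl : left_distributive gmul +%R.
Proof.
move=> f g h; apply: gcoefP => x; rewrite gcoefD !gcoef_gmul -big_split /=.
by apply: eq_bigr => y _; rewrite gcoefD mulrDl.
Qed.

Fact gmulDr : right_distributive gmul +%R.
Proof.
move=> f g h; apply: gcoefP => x; rewrite gcoefD !gcoef_gmul -big_split /=.
by apply: eq_bigr => y _; rewrite gcoefD mulrDr.
Qed.

Fact gelt1_neq0 : gelt 1%g != 0.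
Proof.
apply/eqP => /(congr1 (gcoef^~ 1%g))/eqP.
by rewrite gcoef_gelt eqxx /gcoef ffunE oner_eq0.
Qed.

HB.instance Definition _ := GRing.Zmodule_isNzRing.Build galg
  gmulA gmul1g gmulg1 gmulDl gmulDr gelt1_neq0.

Fact gscaleAl (a : K) (f g : galg) : a *: (f * g) = (a *: f) * g.
Proof.
apply: gcoefP => x; rewrite gcoefZ !gcoef_gmul big_distrr /=.
by apply: eq_bigr => y _; rewrite gcoefZ mulrA.
Qed.

HB.instance Definition _ := GRing.Lmodule_isLalgebra.Build K galg gscaleAl.

Fact gscaleAr (a : K) (f g : galg) : a *: (f * g) = f * (a *: g).
Proof.
apply: gcoefP => x; rewrite gcoefZ !gcoef_gmul big_distrr /=.
by apply: eq_bigr => y _; rewrite gcoefZ mulrCA.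
Qed.

HB.instance Definition _ := GRing.Lalgebra_isAlgebra.Build K galg gscaleAr.

Definition gsupp (f : galg) : {set gT} := [set x | gcoef f x != 0]%SET.

End GroupAlgebra.

Section StarAlgebra.
Variables (R : realType) (gT : finGroupType).
Local Notation C := R[i].
Local Notation CG := (galg C gT).

Definition gstar (f : CG) : CG := \sum_x (gcoef f x)^* *: gelt C x^-1%g.

Definition gnorm1 (f : CG) : R := \sum_x Normc.normc (gcoef f x).

(* [{lrmorphism _}] requires [pi 1 = 1]; this costs nothing, since [pi 1] is an
   idempotent unitary matrix. *)
Definition star_rep n (pi : {lrmorphism CG -> 'M[C]_n.+1}) : Prop :=
  (forall x, pi (gelt C x) \is unitarymx) /\
  (forall f, pi (gstar f) = (pi f)^t*).

Definition spectrum_in (alpha : R) (f : CG) : Prop :=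
  forall n (pi : {lrmorphism CG -> 'M[C]_n.+1}), star_rep pi ->
  forall a, eigenvalue (pi f) a -> alpha%:C <= a <= 1.

Definition psdmx n (A : 'M[C]_n) : Prop :=
  A \is hermsymmx /\ (forall u : 'rV[C]_n, 0 <= (u *m A *m u^t*) 0 0).

Definition gnonneg (f : CG) : Prop :=
  forall n (pi : {lrmorphism CG -> 'M[C]_n.+1}), star_rep pi -> psdmx (pi f).

(* For [f] nonnegative the defining property has a unique solution, so the
   default value of [xget] plays no role; likewise for [best_sqrt_approx]
   below when [alpha < 1]. *)
Definition gsqrt (f : CG) : CG :=
  xget 0 [set h | [/\ gnonneg h, gstar h = h & h ^+ 2 = f]].

Definition gpeval (p : {poly R}) (f : CG) : CG :=
  horner_alg f (map_poly (real_complex R) p).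

End StarAlgebra.

Section BestApproximation.
Variable R : realType.

(* The supremum is attained on the compact interval, so it is a maximum. *)
Definition sqrt_err (alpha : R) (p : {poly R}) : R :=
  sup [set `|p.[t] - Num.sqrt t| | t in `[alpha, 1]].

Definition best_sqrt_approx (alpha : R) (k : nat) : {poly R} :=
  xget 0 [set p : {poly R} | (size p <= k.+1)%N /\
    forall q : {poly R}, (size q <= k.+1)%N ->
      sqrt_err alpha p <= sqrt_err alpha q].

End BestApproximation.

Section SumsOfSquares.
Variables (R : realType) (gT : finGroupType).
Local Notation C := R[i].
Local Notation CG := (galg C gT).

Definition supp_upto (alpha : R) (f : CG) (d : nat) : {set gT} :=
  (\bigcup_(k < d.+1) gsupp (gpeval (best_sqrt_approx alpha k) f))%SET.

(* Rows and columns of [Q] are indexed by [S] through [enum_val]. *)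
Definition gram_elt (S : {set gT}) (Q : 'M[C]_#|S|) : CG :=
  \sum_i \sum_j Q i j *: gelt C ((enum_val i)^-1 * enum_val j)%g.

Definition sos_shift (S : {set gT}) (f : CG) : set R :=
  [set l | 0 <= l /\
    exists2 Q : 'M[C]_#|S|, psdmx Q & f + l%:C *: 1 = gram_elt Q].

Definition is_min (A : set R) (m : R) : Prop := A m /\ lbound A m.

Definition sos_beta (alpha : R) (f : CG) (d : nat) : R :=
  Num.min
    (2 * gnorm1 (gsqrt f) * (#|gT|%:R - #|supp_upto alpha f d|%:R))
    (3 * #|gsupp f|%:R ^+ d).

End SumsOfSquares.

(* Main.v *)
From HB Require Import structures.
Require Import Defs.
From mathcomp Require Import all_boot all_order all_fingroup all_algebra.
From mathcomp Require Import complex.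
From mathcomp Require Import all_classical all_reals.
From mathcomp Require Import topology normedtype derive realfun.
From mathcomp Require Import ring lra zify.

Set Implicit Arguments.
Unset Strict Implicit.
Unset Printing Implicit Defensive.

Import Order.TTheory GRing.Theory Num.Theory.
Import numFieldNormedType.Exports.
Local Open Scope ring_scope.
Local Open Scope complex_scope.

(** Let p be a best approximation of the square root of degree at most d on
    [alpha, 1], with uniform error e.  The bound follows from two independent
    facts: e decays in d at the stated rate, and delta <= e * beta.

    For the second fact, any g supported in S = S_d gives an admissible shift.
    The residual r = f - g^* g is supported in S^-1 S, because S contains 1 and
    the support of f (the best approximations of degrees 0 and 1 have a nonzero
    constant, resp. linear, coefficient).  Each term of r is repaired
    separately: for y, z in S, the element
    |c| 1 + (c y^-1 z + conj c z^-1 y) / 2 is |c| / 2 times the hermitian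
    square of y + (c / |c|) z, so the coefficient norm of r is an admissible
    lambda ([sos_shift_residual]).  Two choices of g give the two members of the
    minimum.
    - The restriction to S of h = sqrt f.  The regular representation turns h
      into a positive semidefinite matrix with eigenvalues m, and h - p(f) into
      one with eigenvalues m - p(m^2), of absolute value at most e.  A row of
      the latter lists the coefficients of h - p(f), so each of them is at most
      e; outside S they are the coefficients of h ([sos_shift_tail]).
    - p(f) itself.  The eigenvalues of f - p(f)^2 are m^2 - p(m^2)^2, at most
      3 e, hence so is the euclidean norm of the coefficient vector.  Its
      support consists of products of 2 d elements of supp f, and
      Cauchy-Schwarz gives the norm 3 e |supp f|^d ([sos_shift_words]).

    The rate of decay needs no sharp constant.  Since alpha^2 < alpha, the ratio
    (1 - alpha^2) / (1 + alpha^2) exceeds 1 - alpha, so for alpha > 0 the Taylor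
    polynomial at 1, with error at most (1 - alpha)^d, suffices, and the factor
    1 / sqrt (2 d - 1) is absorbed in the constant.  For alpha = 0 an
    approximant with error 1 / d is built from Chebyshev polynomials.  Both come
    from one principle ([horner_sqrt_dist]): with s = sqrt t the derivative of
    q(s^2) / s is - (q - 2 t q')(s^2) / s^2, so if q - 2 t q' is small then q is
    nearly proportional to the square root.

    That delta is a minimum, and that best approximations exist, are
    compactness statements ([box_min]): Gram matrices of bounded shift have
    bounded trace, hence bounded entries, and a polynomial is determined by its
    values at d + 1 nodes of [alpha, 1]. *)

(** * Polynomial approximation of the square root *)

Section SqrtApprox.
Local Open Scope classical_set_scope.
Variable R : realType.

Lemma ler_dist_derive (F G dF dG : R -> R) (a b : R) : a <= b ->
  (forall s, s \in `[a, b]%R -> is_derive s 1 F (dF s)) ->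
  (forall s, s \in `[a, b]%R -> is_derive s 1 G (dG s)) ->
  (forall s, s \in `[a, b]%R -> `|dF s| <= dG s) ->
  `|F b - F a| <= G b - G a.
Proof.
move=> ab HF HG H.
have step (K dK : R -> R) : (forall s, s \in `[a, b]%R -> is_derive s 1 K (dK s)) ->
   (forall s, s \in `[a, b]%R -> 0 <= dK s) -> K a <= K b.
  move=> HK K0.
  have HK' x : x \in `]a, b[%R -> is_derive x 1 K (dK x).
    by move=> xab; apply: HK; exact: subset_itv_oo_cc xab.
  have cK : {within `[a, b], continuous K}.
    by apply: derivable_within_continuous => x xab; have [] := HK x xab.
  have [c cab E] := @MVT_segment R K dK a b ab HK' cK.
  by rewrite -subr_ge0 E mulr_ge0 ?K0 // subr_ge0.
have := step (G - F) (dG - dF) _ _; have := step (G + F) (dG + dF) _ _.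
rewrite !fctE => h1 h2.
have {h1}: G a + F a <= G b + F b.
  apply: h1 => s sab; first by have := HF s sab; have := HG s sab => ? ?; apply: is_deriveD.
  by have := H s sab; rewrite ler_norml => /andP[? ?]; lra.
have {h2}: G a - F a <= G b - F b.
  apply: h2 => s sab; first by have := HF s sab; have := HG s sab => ? ?; apply: is_deriveB.
  by have := H s sab; rewrite ler_norml => /andP[? ?]; lra.
by rewrite ler_norml; lra.
Qed.

(** The Taylor polynomial P_d of sqrt t at t = 1, together with the constant c_d
    such that P_d - 2 t P_d' = c_d (1 - t)^d.  Generating both at once keeps the
    binomial coefficients implicit: the next Taylor coefficient is
    - c_d / (2 (d + 1)). *)
Fixpoint binom_pair (d : nat) : {poly R} * R :=
  if d is d'.+1 then
    let: (P, c) := binom_pair d' in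
    (P - (c / (2 * d%:R))%:P * (1 - 'X) ^+ d,
     c * (2 * d%:R - 1) / (2 * d%:R))
  else (1, 1).
Definition sqrt_taylor d := (binom_pair d).1.
Definition sqrt_taylor_rest d := (binom_pair d).2.

Lemma sqrt_taylorS d : sqrt_taylor d.+1 =
  sqrt_taylor d - (sqrt_taylor_rest d / (2 * d.+1%:R))%:P * (1 - 'X) ^+ d.+1.
Proof. by rewrite /sqrt_taylor /sqrt_taylor_rest /=; case: binom_pair. Qed.

Lemma sqrt_taylor_restS d : sqrt_taylor_rest d.+1 =
  sqrt_taylor_rest d * (2 * d.+1%:R - 1) / (2 * d.+1%:R).
Proof. by rewrite /sqrt_taylor_rest /=; case: binom_pair. Qed.

Lemma sqrt_taylor_rest_itv d : 0 <= sqrt_taylor_rest d <= 1.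
Proof.
elim: d => [|d /andP[h0 h1]]; first by rewrite /sqrt_taylor_rest /= ler01 lexx.
have d1 : 1 <= d.+1%:R :> R by rewrite ler1n.
rewrite sqrt_taylor_restS; apply/andP; split.
  by rewrite divr_ge0 ?mulr_ge0 //; lra.
rewrite ler_pdivrMr; last lra.
by rewrite mul1r (le_trans (y := 1 * (2 * d.+1%:R - 1))) // ?ler_wpM2r; lra.
Qed.

Lemma size_sqrt_taylor d : (size (sqrt_taylor d) <= d.+1)%N.
Proof.
elim: d => [|d ih]; first by rewrite /sqrt_taylor size_polyC leq_b1.
rewrite sqrt_taylorS (leq_trans (size_polyD _ _)) // geq_max (leq_trans ih) //=.
rewrite size_polyN mul_polyC (leq_trans (size_scale_leq _ _)) //.
rewrite (leq_trans (size_poly_exp_leq _ _)) // ltnS.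
have -> : (1 - 'X : {poly R}) = - ('X - 1%:P) by rewrite opprB.
by rewrite size_polyN size_XsubC mul1n.
Qed.

Lemma sqrt_taylor_ode d :
  sqrt_taylor d - 2%:P * 'X * deriv (sqrt_taylor d) =
  (sqrt_taylor_rest d)%:P * (1 - 'X) ^+ d.
Proof.
elim: d => [|d ih].
  by rewrite /sqrt_taylor /sqrt_taylor_rest /= -[1]/(1%:P) derivC mulr0 subr0 expr0 mulr1.
have d0 : 1 + d%:R != 0 :> R by rewrite nat1r pnatr_eq0.
rewrite sqrt_taylorS sqrt_taylor_restS derivB derivM derivC mul0r add0r.
have dX : deriv (1 - 'X) = - 1 :> {poly R} by rewrite derivB derivX derivC sub0r.
rewrite deriv_exp dX /=.
set P := sqrt_taylor d in ih *; set c := sqrt_taylor_rest d in ih *.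
set k := (c / (2 * d.+1%:R)).
have kE : c%:P = (d.+1%:R * 2 * k)%:P :> {poly R} by congr (_%:P); rewrite /k; field.
have -> : c * (2 * d.+1%:R - 1) / (2 * d.+1%:R) = (2 * d.+1%:R - 1) * k.
  by rewrite /k; field.
transitivity ((P - 2%:P * 'X * deriv P) - k%:P * (1 - 'X) ^+ d.+1
   - 2%:P * 'X * k%:P * (1 - 'X) ^+ d *+ d.+1); first by rewrite -mulr_natr; ring.
rewrite ih kE exprS -mulr_natr; ring.
Qed.

(** Comparison of q(x^2) / x with - K / x between sqrt t and 1; the functions
    q for which q - 2 t q' vanishes are the multiples of sqrt t. *)
Lemma horner_sqrt_dist (q : {poly R}) (alpha K : R) : 0 <= alpha ->
  (forall t, alpha <= t <= 1 -> `|(q - 2%:P * 'X * deriv q).[t]| <= K) ->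
  forall t, alpha <= t <= 1 -> `|q.[1] * Num.sqrt t - q.[t]| <= K.
Proof.
move=> a0 HK t /andP[at_ t1].
have t0 : 0 <= t by apply: le_trans at_.
have K0 : 0 <= K by apply: le_trans (HK 1 _); rewrite ?lexx ?(le_trans at_).
have [tE|tn0] := eqVneq t 0.
  have := HK 0; rewrite -{1}tE at_ ler01 => /(_ isT).
  by rewrite tE sqrtr0 mulr0 sub0r normrN !hornerE subr0.
set s := Num.sqrt t.
have s0 : 0 < s by rewrite sqrtr_gt0 lt_def tn0.
have s1 : s <= 1 by rewrite -[1]sqrtr1 ler_wsqrtr.
have tE : t = s ^+ 2 by rewrite sqr_sqrtr.
pose p := q \Po 'X^2.
have dV x : x != 0 -> is_derive x (1 : R) (fun y => y^-1) (- x ^- 2).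
  move=> x0; have := is_deriveV x0 (is_derive_id x (1 : R)).
  by rewrite /GRing.scale /= mulr1.
have HF x : x \in `[s, 1]%R -> is_derive x 1 (fun y => p.[y] * y^-1)
    (- (q - 2%:P * 'X * deriv q).[x ^+ 2] / x ^+ 2).
  rewrite in_itv /= => /andP[sx _].
  have x0 : x != 0 by rewrite gt_eqF // (lt_le_trans s0).
  apply: (trigger_derive (is_deriveM (is_derive_poly p x) (dV x x0))).
  rewrite /p deriv_comp !hornerE !horner_comp !hornerE derivXn !hornerE /=.
  by rewrite /GRing.scale /=; field.
have HG x : x \in `[s, 1]%R -> is_derive x 1 (fun y => - K * y^-1) (K / x ^+ 2).
  rewrite in_itv /= => /andP[sx _].
  have x0 : x != 0 by rewrite gt_eqF // (lt_le_trans s0).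
  apply: (trigger_derive (is_deriveZ (- K) (dV x x0))).
  by rewrite /GRing.scale /=; field.
have := ler_dist_derive s1 HF HG.
rewrite invr1 !mulr1 /p !horner_comp !hornerE expr1n -tE => H.
have -> : q.[1] * s - q.[t] = s * (q.[1] - q.[t] / s) by field; rewrite gt_eqF.
rewrite normrM gtr0_norm //.
have {}H : `|q.[1] - q.[t] / s| <= - K - - K / s.
  apply: H => x; rewrite in_itv /= => /andP[sx x1].
  have x0 : 0 < x by apply: lt_le_trans sx.
  rewrite normrM normrN ger0_norm ?invr_ge0 ?sqr_ge0 //.
  rewrite [leRHS]/GRing.mul /= ler_wpM2r ?invr_ge0 ?sqr_ge0 ?HK //.
  apply/andP; split; last by rewrite exprn_ile1 // ltW.
  by rewrite (le_trans at_) // tE ler_pXn2r ?nnegrE // ltW.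
rewrite (le_trans (ler_wpM2l (ltW s0) H)) //.
rewrite (_ : s * _ = K * (1 - s)); last by field; rewrite gt_eqF.
by rewrite ler_piMr //; lra.
Qed.

(** With t = (sin x)^2, these are cos (2 n x) and sin (2 n x) / sin (2 x) as
    polynomials in t; the recursion is the addition theorem. *)
Fixpoint cheb_pair (n : nat) : {poly R} * {poly R} :=
  if n is n'.+1 then
    let: (c, y) := cheb_pair n' in
    ((1 - 2%:P * 'X) * c - 4%:P * 'X * (1 - 'X) * y,
     c + (1 - 2%:P * 'X) * y)
  else (1, 0).
Definition cheb n := (cheb_pair n).1.
Definition chebU n := (cheb_pair n).2.

Lemma chebS n : cheb n.+1 =
  (1 - 2%:P * 'X) * cheb n - 4%:P * 'X * (1 - 'X) * chebU n.
Proof. by rewrite /cheb /chebU /=; case: cheb_pair. Qed.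

Lemma chebUS n : chebU n.+1 = cheb n + (1 - 2%:P * 'X) * chebU n.
Proof. by rewrite /cheb /chebU /=; case: cheb_pair. Qed.

(** This is cos^2 + sin^2 = 1, as sin (2 x)^2 = 4 t (1 - t). *)
Lemma cheb_pell n : cheb n ^+ 2 + 4%:P * 'X * (1 - 'X) * chebU n ^+ 2 = 1.
Proof.
elim: n => [|n ih]; first by rewrite /cheb /chebU /=; ring.
by rewrite chebS chebUS -[RHS]ih; ring.
Qed.

Lemma cheb_le1 n t : 0 <= t <= 1 -> `|(cheb n).[t]| <= 1.
Proof.
move=> /andP[t0 t1].
have E : (cheb n).[t] ^+ 2 + 4 * t * (1 - t) * (chebU n).[t] ^+ 2 = 1.
  by have := congr1 (horner^~ t) (cheb_pell n); rewrite !hornerE /= => E; rewrite -[RHS]E; ring.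
rewrite -[leRHS]ger0_norm // -ler_sqr ?nnegrE // !real_normK ?num_real //.
rewrite expr1n -[leRHS]E lerDl mulr_ge0 ?sqr_ge0 //.
by rewrite !mulr_ge0 // subr_ge0.
Qed.

(** Differentiation with respect to the angle, using dt = sin (2 x) dx. *)
Lemma deriv_cheb n : deriv (cheb n) = - (2 * n%:R)%:P * chebU n /\
  2%:P * 'X * (1 - 'X) * deriv (chebU n) =
    (n%:R)%:P * cheb n - (1 - 2%:P * 'X) * chebU n.
Proof.
elim: n => [|n [ih1 ih2]].
  by rewrite /cheb /chebU /= derivC deriv0; split; ring.
have dA : deriv (1 - 2%:P * 'X) = - 2%:P :> {poly R}.
  by rewrite derivB derivM derivX !derivC; ring.
have dB : deriv (4%:P * 'X * (1 - 'X)) = 4%:P * (1 - 2%:P * 'X) :> {poly R}.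
  by rewrite !derivM derivB derivX !derivC; ring.
rewrite chebS chebUS derivB derivD (derivM (1 - _)) (derivM (4%:P * 'X * _)).
rewrite (derivM (1 - _)) dA dB ih1; split.
  transitivity (- 2%:P * cheb n - (1 - 2%:P * 'X) * ((2 * n%:R)%:P * chebU n)
     - 4%:P * (1 - 2%:P * 'X) * chebU n
     - 2%:P * (2%:P * 'X * (1 - 'X) * deriv (chebU n))); first by ring.
  by rewrite ih2; ring.
transitivity ((1 - 2%:P * 'X) * (2%:P * 'X * (1 - 'X) * deriv (chebU n))
  - 2%:P * 'X * (1 - 'X) * ((2 * n%:R)%:P + 2%:P) * chebU n); first by ring.
by rewrite ih2; ring.
Qed.

(** This is sin ((2 n + 1) x) / sin x. *)
Definition chebV n := cheb n + 2%:P * (1 - 'X) * chebU n.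
Definition cheb_int n := \sum_(j < n) (2 * j%:R + 1)^-1 *: chebV j.
(** Solution q of q - 2 t q' = cos (2 n x).  The sum in [cheb_int] is, up to the
    factor sin x, a partial sum of the Fourier series of a square wave, so
    this is in essence the Fourier approximation of |sin x|. *)
Definition abs_cheb n := cheb n + (4 * n%:R)%:P * 'X * cheb_int n.

Lemma cheb_intE n : cheb_int n + 2%:P * 'X * deriv (cheb_int n) = chebU n.
Proof.
elim: n => [|n ih].
  by rewrite /cheb_int big_ord0 /chebU /= deriv0; ring.
have n0 : 2 * n%:R + 1 != 0 :> R.
  by rewrite gt_eqF // ltr_wpDl // mulr_ge0.
rewrite /cheb_int big_ord_recr /= -/(cheb_int n) derivD derivZ -!mul_polyC.
have [h1 h2] := deriv_cheb n.
transitivity (cheb_int n + 2%:P * 'X * deriv (cheb_int n) +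
  ((2 * n%:R + 1)^-1)%:P * (chebV n + 2%:P * 'X * deriv (chebV n))); first ring.
have -> : chebV n + 2%:P * 'X * deriv (chebV n) =
    (2 * n%:R + 1)%:P * (cheb n - 2%:P * 'X * chebU n).
  have dX : deriv (1 - 'X) = - 1 :> {poly R} by rewrite derivB derivX derivC sub0r.
  rewrite /chebV derivD !derivM derivC dX h1.
  transitivity (cheb n + 2%:P * (1 - 'X) * chebU n - 4%:P * 'X * chebU n
    - 2%:P * 'X * (2 * n%:R)%:P * chebU n
    + 2%:P * (2%:P * 'X * (1 - 'X) * deriv (chebU n))); first ring.
  by rewrite h2; ring.
rewrite ih mulrA -polyCM mulVf // polyC1 chebUS; ring.
Qed.

Lemma abs_chebE n : abs_cheb n - 2%:P * 'X * deriv (abs_cheb n) = cheb n.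
Proof.
rewrite /abs_cheb derivD !derivM derivC derivX (deriv_cheb n).1.
transitivity (cheb n + (4 * n%:R)%:P * 'X * chebU n - (4 * n%:R)%:P * 'X *
   (cheb_int n + 2%:P * 'X * deriv (cheb_int n))); first ring.
by rewrite cheb_intE; ring.
Qed.

Lemma cheb1 n : (cheb n).[1] = (-1) ^+ n.
Proof.
elim: n => [|n ih]; first by rewrite /cheb /= hornerE.
by rewrite chebS !hornerE ih exprS; ring.
Qed.

(** Partial sums of the Leibniz series of pi / 4.  The second summand on the
    left makes the bound inductive: it anticipates the negative term that
    follows a positive one. *)
Lemma leibniz_ge n :
  2%:R / 3%:R + (odd n.+1)%:R / (2 * n%:R + 3)
    <= \sum_(j < n.+1) (2 * j%:R + 1)^-1 * (-1) ^+ j :> R.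
Proof.
elim: n => [|n ih]; first by rewrite big_ord1 /= expr0 mulr0 !add0r invr1; lra.
rewrite big_ord_recr /= -signr_odd /=.
rewrite -[n.+1%:R]natr1; have n0 : 0 <= n%:R :> R by [].
have i1 : 2 * (n%:R + 1) + 1 = 2 * n%:R + 3 :> R by ring.
rewrite /= in ih *; rewrite i1; case: (odd n) ih => /= ih.
  have : (2 * (n%:R + 1) + 3)^-1 <= (2 * n%:R + 3)^-1 :> R by rewrite lef_pV2 ?posrE; lra.
  rewrite expr0; lra.
by rewrite expr1; lra.
Qed.

Lemma abs_cheb1_ge n : n.+1%:R <= (abs_cheb n.+1).[1].
Proof.
rewrite /abs_cheb !hornerE cheb1 /cheb_int horner_sum.
under eq_bigr => j _ do rewrite /chebV !hornerE cheb1 subrr mulr0 mul0r addr0.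
have h := leibniz_ge n.
have n0 : 1 <= n.+1%:R :> R by rewrite ler1n.
have {h} : 2%:R / 3%:R <= \sum_(j < n.+1) (2 * j%:R + 1)^-1 * (-1) ^+ j :> R.
  apply: le_trans h; rewrite lerDl divr_ge0 //.
  by rewrite addr_ge0 // mulr_ge0.
have : -1 <= (-1) ^+ n.+1 :> R by rewrite -signr_odd; case: odd; rewrite ?expr0 ?expr1; lra.
set A := \sum_(j < _) _; nra.
Qed.

Lemma size_cheb_pair n :
  (size (cheb n) <= n.+1)%N /\ (size (chebU n) <= n)%N.
Proof.
have sX : (size (1 - 'X : {poly R})%R <= 2)%N.
  by rewrite -size_polyN opprB size_XsubC.
have s2X : (size (1 - 2%:P * 'X : {poly R})%R <= 2)%N.
  rewrite (leq_trans (size_polyD _ _)) // geq_max size_polyC size_polyN mul_polyC.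
  rewrite (leq_trans (leq_b1 _)) //= (leq_trans (size_scale_leq _ _)) //.
  by rewrite size_polyX.
elim: n => [|n [ih1 ih2]].
  by rewrite /cheb /chebU /= size_poly0 size_polyC leq_b1.
rewrite chebS chebUS; split.
  rewrite (leq_trans (size_polyD _ _)) // geq_max size_polyN; apply/andP; split.
    by rewrite (leq_trans (size_polyMleq _ _)) //; lia.
  rewrite -!mulrA mul_polyC (leq_trans (size_scale_leq _ _)) //.
  rewrite ['X * _]mulrC (leq_trans (size_polyMleq _ _)) // size_polyX addn2 /= ltnS.
  by rewrite (leq_trans (size_polyMleq _ _)) //; lia.
rewrite (leq_trans (size_polyD _ _)) // geq_max ih1.
by rewrite (leq_trans (size_polyMleq _ _)) //; lia.
Qed.

Lemma size_abs_cheb n : (size (abs_cheb n) <= n.+1)%N.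
Proof.
have [h _] := size_cheb_pair n.
rewrite (leq_trans (size_polyD _ _)) // geq_max h /=.
rewrite -mulrA mul_polyC (leq_trans (size_scale_leq _ _)) //.
rewrite mulrC (leq_trans (size_polyMleq _ _)) // size_polyX addn2 /= ltnS.
rewrite (leq_trans (size_sum _ _ _)) //; apply/bigmax_leqP => j _.
rewrite (leq_trans (size_scale_leq _ _)) // (leq_trans (size_polyD _ _)) //.
have [h1 h2] := size_cheb_pair j; have jn := ltn_ord j.
rewrite geq_max (leq_trans h1) //= -mulrA mul_polyC (leq_trans (size_scale_leq _ _)) //.
rewrite (leq_trans (size_polyMleq _ _)) //.
have : (size (1 - 'X : {poly R})%R <= 2)%N by rewrite -size_polyN opprB size_XsubC.
by lia.
Qed.

Lemma sqrt_approx_geometric (alpha : R) d : 0 <= alpha ->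
  exists2 q : {poly R}, (size q <= d.+1)%N &
    forall t, alpha <= t <= 1 -> `|q.[t] - Num.sqrt t| <= (1 - alpha) ^+ d.
Proof.
move=> a0; exists (sqrt_taylor d) => [|t /andP[at_ t1]]; first exact: size_sqrt_taylor.
have -> : Num.sqrt t = (sqrt_taylor d).[1] * Num.sqrt t.
  suff -> : (sqrt_taylor d).[1] = 1 by rewrite mul1r.
  elim: d => [|d ih]; first by rewrite /sqrt_taylor hornerE.
  by rewrite sqrt_taylorS !hornerE ih subrr expr0n mulr0 subr0.
rewrite distrC; apply: horner_sqrt_dist a0 _ _ _; last by rewrite at_.
move=> x /andP[ax x1]; rewrite sqrt_taylor_ode !hornerE normrM.
have /andP[c0 c1] := sqrt_taylor_rest_itv d.
rewrite !ger0_norm ?exprn_ge0 ?subr_ge0 //.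
rewrite (le_trans (ler_piMl _ c1)) ?exprn_ge0 ?subr_ge0 //.
by rewrite lerXn2r ?nnegrE; lra.
Qed.

Lemma sqrt_approx_inverse d : (0 < d)%N ->
  exists2 q : {poly R}, (size q <= d.+1)%N &
    forall t, 0 <= t <= 1 -> `|q.[t] - Num.sqrt t| <= d%:R^-1.
Proof.
case: d => // d _; set A := (abs_cheb d.+1).[1].
have dA : d.+1%:R <= A := abs_cheb1_ge d.
have A0 : 0 < A by apply: lt_le_trans dA; rewrite ltr0n.
exists (A^-1 *: abs_cheb d.+1) => [|t t01].
  by rewrite (leq_trans (size_scale_leq _ _)) // size_abs_cheb.
rewrite hornerE.
have -> : A^-1 * (abs_cheb d.+1).[t] - Num.sqrt t =
   - A^-1 * (A * Num.sqrt t - (abs_cheb d.+1).[t]).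
  by field; rewrite gt_eqF.
rewrite normrM normrN [`|A^-1|]gtr0_norm ?invr_gt0 //.
apply: (le_trans (y := A^-1)); last by rewrite lef_pV2 // posrE ltr0n.
rewrite ler_piMr ?invr_ge0 ?(ltW A0) //.
apply: horner_sqrt_dist t t01 => // x x01.
by rewrite abs_chebE cheb_le1.
Qed.

End SqrtApprox.

(** * Best approximations *)

Section CompactMin.
Local Open Scope classical_set_scope.
Variables (R : realType) (n : nat).

Lemma rV_lipschitz_continuous (E : 'rV[R]_n -> R) (M : 'I_n -> R) :
  (forall u v, `|E u - E v| <= \sum_i M i * `|u 0 i - v 0 i|) ->
  continuous E.
Proof.
move=> HE u; apply/(@cvgrPdist_le _ _ _ (nbhs u) (nbhs_filter u)) => e e0.
pose K := \sum_i `|M i|.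
have K0 : 0 <= K by apply: sumr_ge0.
have d0 : 0 < e / (K + 1) by rewrite divr_gt0 // ltr_wpDl.
have near1 i : nbhs u [set v : 'rV[R]_n | `|u 0 i - v 0 i| <= e / (K + 1)].
  have /(@cvgrPdist_le _ _ _ (nbhs u) (nbhs_filter u)) :=
    @coord_continuous R 1 n 0 i u.
  exact.
have nearall : nbhs u [set v : 'rV[R]_n |
    forall i, `|u 0 i - v 0 i| <= e / (K + 1)].
  exact: (@filter_forall _ _ _ (nbhs u) (nbhs_filter u)).
apply: filterS nearall => v /= H; rewrite (le_trans (HE _ _)) //.
rewrite (le_trans (y := \sum_i `|M i| * (e / (K + 1)))) //.
  apply: ler_sum => i _; rewrite (le_trans (ler_norm _)) // normrM normr_id.
  by rewrite ler_wpM2l.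
rewrite -mulr_suml -/K mulrCA ler_piMr ?(ltW e0) //.
by rewrite ler_pdivrMr ?ltr_wpDl // mul1r lerDl.
Qed.

Lemma box_min (E : 'rV[R]_n -> R) (D : set 'rV[R]_n) (B : R)
  (A := [set v : 'rV[R]_n | forall i, `|v 0 i| <= B] `&` D) :
  continuous E -> closed D -> A !=set0 ->
  exists2 u, A u & forall v, A v -> E u <= E v.
Proof.
move=> cE cD A0.
have cA : compact A.
  apply: compact_closedI cD.
  have -> : [set v : 'rV[R]_n | forall i, `|v 0 i| <= B] =
      [set v : 'rV[R]_n | forall i, `[- B, B]%classic (v 0 i)].
    by apply/seteqP; split=> v /= h i; have := h i; rewrite /= in_itv /= -ler_norml.
  apply: (@rV_compact R n (fun=> `[- B, B])) => i; exact: segment_compact.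
have [c cA1 cmin] := compact_EVT_min A0 cA (continuous_subspaceT cE).
by exists c => [|v Av]; [rewrite inE in cA1 | apply: cmin; rewrite inE].
Qed.

End CompactMin.

Section BestApprox.
Local Open Scope classical_set_scope.
Variable R : realType.
Implicit Types p q : {poly R}.

Lemma interpolation (K : fieldType) (l : seq K) (g : K -> K) :
  exists2 p : {poly K}, (size p <= size l)%N & {in l, forall x, p.[x] = g x}.
Proof.
elim: l => [|x l [p sp Hp]]; first by exists 0; rewrite ?size_poly0.
have [xl|xl] := boolP (x \in l).
  exists p => [|y]; first exact: leqW.
  by rewrite inE => /predU1P[->|]; exact: Hp.
pose m := \prod_(y <- l) ('X - y%:P).
have mx : m.[x] != 0.
  by rewrite -[_ == 0]/(root m x) root_prod_XsubC.
exists (p + ((g x - p.[x]) / m.[x]) *: m) => [|y].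
  rewrite (leq_trans (size_polyD _ _)) // geq_max (leqW sp) /=.
  by rewrite (leq_trans (size_scale_leq _ _)) // size_prod_XsubC.
rewrite inE hornerD hornerZ => /predU1P[->|yl]; first by rewrite divfK // addrC subrK.
have /rootP -> : root m y by rewrite root_prod_XsubC.
by rewrite mulr0 addr0 Hp.
Qed.

Lemma horner_itv_bounded p (alpha : R) : exists M, forall t, alpha <= t <= 1 -> 0 <= alpha ->
  `|p.[t]| <= M.
Proof.
exists (\sum_(i < size p) `|p`_i|) => t /andP[at_ t1] a0.
rewrite horner_coef (le_trans (ler_norm_sum _ _ _)) //; apply: ler_sum => i _.
by rewrite normrM ler_piMr // normrX exprn_ile1 // ger0_norm // (le_trans a0).
Qed.

Variable alpha : R.
Hypothesis alpha01 : 0 <= alpha < 1.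

Let a0 : 0 <= alpha. Proof. by case/andP: alpha01. Qed.
Let a1 : alpha < 1. Proof. by case/andP: alpha01. Qed.

Lemma sqrt_itv t : alpha <= t <= 1 -> 0 <= Num.sqrt t <= 1.
Proof.
by case/andP=> _ t1; rewrite sqrtr_ge0 -[leRHS]sqrtr1 ler_wsqrtr.
Qed.

Lemma sqrt_err_ub p t : alpha <= t <= 1 -> `|p.[t] - Num.sqrt t| <= sqrt_err alpha p.
Proof.
move=> tI; apply: ub_le_sup; last by exists t; rewrite //= in_itv.
have [M HM] := horner_itv_bounded p alpha.
exists (M + 1) => y [s]; rewrite /= in_itv /= => sI <-.
have /andP[s0 s1] := sqrt_itv sI.
by rewrite (le_trans (ler_normB _ _)) // lerD ?HM // ger0_norm.
Qed.

Lemma sqrt_err_le p e :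
  (forall t, alpha <= t <= 1 -> `|p.[t] - Num.sqrt t| <= e) ->
  sqrt_err alpha p <= e.
Proof.
move=> H; apply: ge_sup; last by move=> y [s]; rewrite /= in_itv /= => /H h <-.
by exists (`|p.[1] - Num.sqrt 1|); exists 1 => //=; rewrite in_itv /= lexx ltW.
Qed.

Lemma sqrt_err_ge0 p : 0 <= sqrt_err alpha p.
Proof. by apply: le_trans (sqrt_err_ub p (t := 1) _); rewrite // lexx ltW. Qed.

Lemma sqrt_err_dist p q M :
  (forall t, alpha <= t <= 1 -> `|(p - q).[t]| <= M) ->
  `|sqrt_err alpha p - sqrt_err alpha q| <= M.
Proof.
have half p' q' M' : (forall t, alpha <= t <= 1 -> `|(p' - q').[t]| <= M') ->
    sqrt_err alpha p' <= sqrt_err alpha q' + M'.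
  move=> H; apply: sqrt_err_le => t tI.
  have -> : p'.[t] - Num.sqrt t = (q'.[t] - Num.sqrt t) + (p' - q').[t].
    by rewrite hornerD hornerN; ring.
  by rewrite (le_trans (ler_normD _ _)) // lerD ?sqrt_err_ub ?H.
move=> H; have h1 := half p q M H.
have h2 : sqrt_err alpha q <= sqrt_err alpha p + M.
  by apply: half => t tI; rewrite -opprB hornerN normrN H.
by rewrite ler_norml; lra.
Qed.

(** Polynomials are parametrized by their values at k + 1 nodes of the interval:
    a competitor that is no worse than 0 is at most 2 in absolute value there,
    so the minimum may be sought in a compact box. *)
Lemma best_approx_exists k : exists p, (size p <= k.+1)%N /\
  forall q, (size q <= k.+1)%N -> sqrt_err alpha p <= sqrt_err alpha q.
Proof.
pose x (i : 'I_k.+1) := alpha + (1 - alpha) / i.+1%:R.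
have xI i : alpha <= x i <= 1.
  have i0 : 0 < i.+1%:R :> R by rewrite ltr0n.
  rewrite /x lerDl divr_ge0 ?subr_ge0 ?(ltW a1) //= -lerBrDl ler_piMr ?subr_ge0 ?(ltW a1) //.
  by rewrite invf_le1 // ler1n.
have xinj : injective x.
  move=> i j /addrI /mulfI H; apply: val_inj => /=.
  have /H/invr_inj/eqP : 1 - alpha != 0 by rewrite subr_eq0 gt_eqF.
  by rewrite eqr_nat => /eqP [].
have /choice[L HL] : forall i : 'I_k.+1, exists p : {poly R}, (size p <= k.+1)%N /\
    forall j, p.[x j] = (j == i)%:R.
  move=> i.
  have [p sp Hp] := interpolation [seq x j | j <- enum 'I_k.+1] (fun y => (y == x i)%:R).
  exists p; split; first by rewrite size_map size_enum_ord in sp.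
  move=> j; rewrite Hp ?(inj_eq xinj) //.
  by apply/mapP; exists j; rewrite ?mem_enum.
pose P (u : 'rV[R]_k.+1) := \sum_i u 0 i *: L i.
have sP u : (size (P u) <= k.+1)%N.
  rewrite (leq_trans (size_sum _ _ _)) //; apply/bigmax_leqP => i _.
  by rewrite (leq_trans (size_scale_leq _ _)) // (HL i).1.
have PE q : (size q <= k.+1)%N -> q = P (\row_i q.[x i]).
  move=> sq; apply/eqP; rewrite -subr_eq0; apply/eqP.
  apply: (@roots_geq_poly_eq0 _ _ [seq x j | j <- enum 'I_k.+1]).
  - apply/allP => _ /mapP[j _ ->]; apply/rootP; rewrite hornerD hornerN horner_sum.
    rewrite (bigD1 j) //= big1 => [|i ij].
      by rewrite hornerZ (HL j).2 eqxx mulr1 mxE addr0 subrr.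
    by rewrite hornerZ (HL i).2 eq_sym (negPf ij) mulr0.
  - by rewrite map_inj_uniq // enum_uniq.
  - rewrite size_map size_enum_ord (leq_trans (size_polyD _ _)) // geq_max sq.
    by rewrite size_polyN sP.
have /choice[M HM] i := horner_itv_bounded (L i) alpha.
have cE : continuous (fun u => sqrt_err alpha (P u)).
  apply: (@rV_lipschitz_continuous _ _ _ M) => u v; apply: sqrt_err_dist => t tI.
  rewrite /P -sumrB horner_sum (le_trans (ler_norm_sum _ _ _)) //.
  apply: ler_sum => i _; rewrite -scalerBl hornerZ normrM mulrC.
  by rewrite ler_wpM2r // HM.
have zero_box : [set v : 'rV[R]_k.+1 | forall i, `|v 0 i| <= 2] `&` [set: _] !=set0.
  by exists 0; split=> // i; rewrite mxE normr0.
have [u [u2 _] umin] := box_min cE closedT zero_box.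
exists (P u); split=> // q sq.
have [q1|q1] := leP (sqrt_err alpha q) 1; last first.
  apply: le_trans (ltW q1); apply: le_trans (umin 0 _) _.
    by split=> // i; rewrite mxE normr0.
  apply: sqrt_err_le => t tI; rewrite /P big1 ?horner0 ?sub0r ?normrN => [|i _].
    by have /andP[s0 s1] := sqrt_itv tI; rewrite ger0_norm.
  by rewrite mxE scale0r.
rewrite [q in leRHS]PE //; apply: umin; split=> // i; rewrite mxE.
rewrite (_ : q.[x i] = (q.[x i] - Num.sqrt (x i)) + Num.sqrt (x i)); last by ring.
rewrite (le_trans (ler_normD _ _)) // -[2]/(1 + 1) lerD //.
  exact: le_trans (sqrt_err_ub _ _) q1.
by have /andP[s0 s1] := sqrt_itv (xI i); rewrite ger0_norm.
Qed.

Lemma best_sqrt_approxP k (p := best_sqrt_approx alpha k) :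
  (size p <= k.+1)%N /\
  forall q, (size q <= k.+1)%N -> sqrt_err alpha p <= sqrt_err alpha q.
Proof. exact: xgetPex (best_approx_exists k). Qed.

Lemma best_sqrt_approx_err_le1 k : sqrt_err alpha (best_sqrt_approx alpha k) <= 1.
Proof.
have [_ H] := best_sqrt_approxP k; have {H} := H 0; rewrite size_poly0 => /(_ isT).
move/le_trans; apply; apply: sqrt_err_le => t tI; rewrite horner0 sub0r normrN.
by have /andP[s0 s1] := sqrt_itv tI; rewrite ger0_norm.
Qed.

Lemma best_sqrt_approx0_neq0 : best_sqrt_approx alpha 0 != 0.
Proof.
have [_ H] := best_sqrt_approxP 0; apply/eqP => p0.
have : sqrt_err alpha 0 <= 2^-1.
  rewrite -p0; apply: le_trans (H (2^-1)%:P _) _; first by rewrite size_polyC leq_b1.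
  apply: sqrt_err_le => t tI; rewrite hornerC.
  by have /andP[s0 s1] := sqrt_itv tI; rewrite ler_norml; lra.
have := @sqrt_err_ub 0 1; rewrite lexx (ltW a1) => /(_ isT).
by rewrite horner0 sqrtr1 sub0r normrN1; lra.
Qed.

(** A constant has error at least (1 - sqrt alpha) / 2, half the oscillation of
    the square root.  The chord, shifted up by (1 - sqrt alpha) / 8, has
    error at most half of that. *)
Lemma size_best_sqrt_approx1 : size (best_sqrt_approx alpha 1) = 2%N.
Proof.
have [sp H] := best_sqrt_approxP 1; apply/eqP; rewrite eqn_leq sp /= ltnNge.
apply/negP => /size1_polyC; set c := _`_0 => pE.
set a := Num.sqrt alpha.
have s0 : 0 <= a := sqrtr_ge0 _.
have aE : alpha = a ^+ 2 by rewrite sqr_sqrtr.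
have s1 : a < 1 by rewrite -sqrtr1 ltr_sqrt.
pose m := (1 - a) / 4.
have m0 : 0 < m by rewrite divr_gt0 ?subr_gt0.
have a10 : a + 1 != 0 by rewrite gt_eqF // ltr_wpDl.
pose q : {poly R} := (a + 1)^-1 *: 'X + (a / (a + 1) + m / 2)%:P.
have : sqrt_err alpha (best_sqrt_approx alpha 1) <= m.
  apply: le_trans (H q _) _.
    rewrite (leq_trans (size_polyD _ _)) // geq_max size_polyC.
    rewrite (leq_trans (size_scale_leq _ _)) ?size_polyX //.
    by rewrite (leq_trans (leq_b1 _)).
  apply: sqrt_err_le => t /andP[at_ t1]; rewrite /q hornerD hornerZ hornerX hornerC.
  set s := Num.sqrt t.
  have sa : a <= s by rewrite ler_wsqrtr.
  have ss1 : s <= 1 by rewrite -[leRHS]sqrtr1 ler_wsqrtr.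
  have -> : t = s ^+ 2 by rewrite sqr_sqrtr // (le_trans a0).
  (* The square root exceeds the chord by (s - a) (1 - s) / (1 + a), which lies
     between 0 and m. *)
  rewrite (_ : _ - s = m / 2 - (s - a) * (1 - s) / (a + 1)); last by field.
  have d0 : 0 <= (s - a) * (1 - s) / (a + 1).
    by rewrite divr_ge0 ?mulr_ge0 ?subr_ge0 // addr_ge0.
  have d1 : (s - a) * (1 - s) / (a + 1) <= m.
    have sq : 0 <= (s - (1 + a) / 2) ^+ 2 := sqr_ge0 _.
    have aa : 0 <= a * (1 - a) by rewrite mulr_ge0 // subr_ge0 ltW.
    by rewrite ler_pdivrMr ?ltr_wpDl // /m; nra.
  by rewrite ler_norml; lra.
have := @sqrt_err_ub (best_sqrt_approx alpha 1) 1.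
have := @sqrt_err_ub (best_sqrt_approx alpha 1) alpha.
rewrite pE !hornerC !lexx (ltW a1) -/a sqrtr1 => /(_ isT) h1 /(_ isT) h2 h3.
have {h1} h1 := le_trans h1 h3; have {h2} h2 := le_trans h2 h3.
by move: h1 h2; rewrite !ler_norml /m; lra.
Qed.

End BestApprox.

(** * The complex group algebra *)

Section GroupAlgebraTheory.
Variables (R : realType) (gT : finGroupType).
Local Notation C := R[i].
Local Notation CG := (galg C gT).
Local Notation normc := Normc.normc.
Implicit Types (f g h : CG) (x y : gT).

Lemma normcE (z : C) : `|z| = (normc z)%:C.
Proof. by case: z. Qed.

Lemma normc_ge0 (z : C) : 0 <= normc z.
Proof. by rewrite -ler0c -normcE. Qed.

Lemma normc_conj (z : C) : normc (z^*%R) = normc z.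
Proof. by apply: complexI; rewrite -!normcE norm_conjC. Qed.

Lemma mulc_conj (z : C) : z * z^*%R = (normc z ^+ 2)%:C.
Proof. by rewrite -normCK normcE rmorphXn. Qed.

Lemma conjcR (a : R) : (a%:C)^*%R = a%:C :> C.
Proof. exact: conjc_real. Qed.

Lemma normc_real (a : R) : normc a%:C = `|a|.
Proof. by rewrite /= expr0n addr0 sqrtr_sqr. Qed.

Lemma gcoef0 x : gcoef (0 : CG) x = 0.
Proof. by rewrite /gcoef ffunE. Qed.

Lemma gcoefN f x : gcoef (- f) x = - gcoef f x.
Proof. by rewrite /gcoef ffunE. Qed.

Lemma gcoefB f g x : gcoef (f - g) x = gcoef f x - gcoef g x.
Proof. by rewrite gcoefD gcoefN. Qed.

Lemma gcoef_sum I (r : seq I) (P : pred I) (F : I -> CG) x :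
  gcoef (\sum_(i <- r | P i) F i) x = \sum_(i <- r | P i) gcoef (F i) x.
Proof.
by elim/big_rec2: _ => [|i a b _ <-]; rewrite (gcoef0, gcoefD).
Qed.

Lemma gcoef1 x : gcoef (1 : CG) x = (x == 1%g)%:R.
Proof. exact: gcoef_gelt. Qed.

Lemma gcoefM f g x : gcoef (f * g) x = \sum_y gcoef f y * gcoef g (y^-1 * x)%g.
Proof. exact: gcoef_gmul. Qed.

Lemma gelt_sum f : f = \sum_x gcoef f x *: gelt C x.
Proof.
apply: gcoefP => x; rewrite gcoef_sum (bigD1 x) //= big1 => [|y yx].
  by rewrite gcoefZ gcoef_gelt eqxx mulr1 addr0.
by rewrite gcoefZ gcoef_gelt eq_sym (negPf yx) mulr0.
Qed.

Lemma geltM x y : gelt C x * gelt C y = gelt C (x * y)%g.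
Proof.
apply: gcoefP => z; rewrite gcoefM (bigD1 x) //= big1 => [|t tx].
  by rewrite !gcoef_gelt eqxx mul1r addr0 -(inj_eq (mulgI x)) mulKVg.
by rewrite gcoef_gelt (negPf tx) mul0r.
Qed.

Lemma gcoef_gstar f x : gcoef (gstar f) x = (gcoef f x^-1%g)^*%R.
Proof.
rewrite /gstar gcoef_sum (bigD1 x^-1%g) //= big1 => [|y yx].
  by rewrite gcoefZ gcoef_gelt invgK eqxx mulr1 addr0.
by rewrite gcoefZ gcoef_gelt -(inj_eq invg_inj) invgK eq_sym (negPf yx) mulr0.
Qed.

Lemma gstarK f : gstar (gstar f) = f.
Proof. by apply: gcoefP => x; rewrite !gcoef_gstar invgK conjCK. Qed.

Lemma gstarD f g : gstar (f + g) = gstar f + gstar g.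
Proof.
by apply: gcoefP => x; rewrite !(gcoef_gstar, gcoefD) (rmorphD (@Num.conj C)).
Qed.

Lemma gstarZ (a : C) f : gstar (a *: f) = a^* *: gstar f.
Proof.
by apply: gcoefP => x; rewrite !(gcoef_gstar, gcoefZ) (rmorphM (@Num.conj C)).
Qed.

Lemma gstar0 : gstar (0 : CG) = 0.
Proof. by apply: gcoefP => x; rewrite gcoef_gstar !gcoef0 conjC0. Qed.

Lemma gstarB f g : gstar (f - g) = gstar f - gstar g.
Proof. by rewrite gstarD -scaleN1r gstarZ rmorphN1 scaleN1r. Qed.

Lemma gstar_sum I (r : seq I) (P : pred I) (F : I -> CG) :
  gstar (\sum_(i <- r | P i) F i) = \sum_(i <- r | P i) gstar (F i).
Proof. exact: (big_morph _ gstarD gstar0). Qed.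

Lemma gstarM f g : gstar (f * g) = gstar g * gstar f.
Proof.
apply: gcoefP => x; rewrite gcoef_gstar !gcoefM (rmorph_sum (@Num.conj C)) /=.
rewrite (reindex_inj (mulgI x^-1%g)) /=; apply: eq_bigr => y _.
by rewrite (rmorphM (@Num.conj C)) !gcoef_gstar !invMg !invgK mulrC mulgK.
Qed.

Lemma gstar1 : gstar (1 : CG) = 1.
Proof.
by apply: gcoefP => x; rewrite gcoef_gstar !gcoef1 conjC_nat -eq_invg1 invgK.
Qed.

Lemma gstar_gelt x : gstar (gelt C x) = gelt C x^-1%g.
Proof.
apply: gcoefP => y; rewrite gcoef_gstar !gcoef_gelt conjC_nat.
by rewrite -(inj_eq invg_inj) invgK.
Qed.

Lemma gnorm1_ge0 f : 0 <= gnorm1 f.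
Proof. by apply: sumr_ge0 => x _; exact: normc_ge0. Qed.

Lemma gnorm1D f g : gnorm1 (f + g) <= gnorm1 f + gnorm1 g.
Proof.
rewrite /gnorm1 -big_split /=; apply: ler_sum => x _.
by rewrite gcoefD le_normcD.
Qed.

Lemma gnorm1_gstar f : gnorm1 (gstar f) = gnorm1 f.
Proof.
rewrite /gnorm1 (reindex_inj invg_inj) /=; apply: eq_bigr => x _.
by rewrite gcoef_gstar invgK normc_conj.
Qed.

Lemma gnorm1M f g : gnorm1 (f * g) <= gnorm1 f * gnorm1 g.
Proof.
rewrite /gnorm1 big_distrl /=.
apply: (le_trans (y := \sum_x \sum_y normc (gcoef f y) * normc (gcoef g (y^-1 * x)%g))).
  apply: ler_sum => x _; rewrite gcoefM.
  elim/big_rec2: _ => [|y a b _ H]; first by rewrite Normc.normc0.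
  by rewrite (le_trans (le_normcD _ _)) // Normc.normcM lerD.
rewrite exchange_big /=; apply: ler_sum => y _.
by rewrite -big_distrr /= [X in _ <= _ * X](reindex_inj (mulgI y^-1%g)).
Qed.

Lemma gsuppD f g : gsupp (f + g) \subset (gsupp f :|: gsupp g)%SET.
Proof.
apply/fintype.subsetP => x; rewrite !inE gcoefD; apply: contraR.
by rewrite negb_or !negbK => /andP[/eqP -> /eqP ->]; rewrite addr0.
Qed.

Lemma gsuppM f g : gsupp (f * g) \subset mulg (gsupp f) (gsupp g).
Proof.
apply/fintype.subsetP => x; rewrite !inE gcoefM; apply: contraR => H.
rewrite big1 // => y _; apply/eqP; rewrite mulf_eq0; apply: contraR H.
rewrite negb_or => /andP[fy gy]; apply/mulsgP.
by exists y (y^-1 * x)%g; rewrite ?inE ?mulKVg.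
Qed.

Lemma gsuppZ (a : C) f : gsupp (a *: f) \subset gsupp f.
Proof.
by apply/fintype.subsetP => x; rewrite !inE gcoefZ; apply: contraNN => /eqP ->; rewrite mulr0.
Qed.

Lemma gsupp1 : gsupp (1 : CG) = [set 1%g]%SET.
Proof. by apply/setP => x; rewrite !inE gcoef1 pnatr_eq0 eqb0 negbK. Qed.

Lemma gsuppN f : gsupp (- f) = gsupp f.
Proof. by apply/setP => x; rewrite !inE gcoefN oppr_eq0. Qed.

Lemma gcoef_notin f x : x \notin gsupp f -> gcoef f x = 0.
Proof. by rewrite inE negbK => /eqP. Qed.

Lemma gpevalC (a : R) f : gpeval a%:P f = a%:C *: 1.
Proof. by rewrite /gpeval map_polyC horner_algC. Qed.

Lemma gpevalX f : gpeval 'X f = f.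
Proof. by rewrite /gpeval map_polyX horner_algX. Qed.

Lemma gpevalD (p q : {poly R}) f : gpeval (p + q) f = gpeval p f + gpeval q f.
Proof. by rewrite /gpeval !rmorphD. Qed.

Lemma gpevalM (p q : {poly R}) f : gpeval (p * q) f = gpeval p f * gpeval q f.
Proof. by rewrite /gpeval !rmorphM. Qed.

Lemma gstar_gpeval (p : {poly R}) f : gstar f = f -> gstar (gpeval p f) = gpeval p f.
Proof.
move=> sf; elim/poly_ind: p => [|p c IH].
  by rewrite -[0]/(0%:P) gpevalC scale0r gstar0.
rewrite gpevalD gpevalM gpevalX gpevalC gstarD gstarM gstarZ gstar1 conjcR IH sf.
have -> : f * gpeval p f = gpeval ('X * p) f by rewrite gpevalM gpevalX.
by rewrite mulrC gpevalM gpevalX.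
Qed.

End GroupAlgebraTheory.

(** * The regular representation *)

Section UnitaryDiagonal.
Local Open Scope sesquilinear_scope.
Variables (C : numClosedFieldType) (n : nat).
Variable V : 'M[C]_n.
Hypothesis V_unitary : V \is unitarymx.
Implicit Types d e : 'I_n -> C.

Definition udiag d : 'M[C]_n := V^t* *m diag_mx (\row_i d i) *m V.

Lemma unitary_mulVt : V *m V^t* = 1%:M.
Proof. exact/unitarymxP. Qed.

Lemma unitary_mulVV : V^t* *m V = 1%:M.
Proof. exact: mulmx1C unitary_mulVt. Qed.

Lemma udiagD d e : udiag d + udiag e = udiag (fun i => d i + e i).
Proof.
rewrite /udiag -mulmxDl -mulmxDr -linearD /=; congr (_ *m diag_mx _ *m _).
by apply/rowP => i; rewrite !mxE.
Qed.

Lemma udiagM d e : udiag d *m udiag e = udiag (fun i => d i * e i).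
Proof.
rewrite /udiag !mulmxA -[_ *m V *m V^t*]mulmxA unitary_mulVt mulmx1.
rewrite -[_ *m diag_mx _ *m diag_mx _]mulmxA mulmx_diag.
by congr (_ *m diag_mx _ *m _); apply/rowP => i; rewrite !mxE.
Qed.

Lemma udiagC (a : C) : udiag (fun=> a) = a%:M.
Proof.
rewrite /udiag.
have -> : \row_(_ < n) a = const_mx a by apply/rowP => i; rewrite !mxE.
by rewrite diag_const_mx mul_mx_scalar -scalemxAl unitary_mulVV scalemx1.
Qed.

Lemma udiag_star d : (udiag d)^t* = udiag (fun i => (d i)^*%R).
Proof.
rewrite /udiag !trmx_mul !map_mxM /= tr_diag_mx trmxCK map_diag_mx mulmxA.
by congr (_ *m diag_mx _ *m _); apply/rowP => i; rewrite !mxE.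
Qed.

Lemma udiag_row d i : row i V *m udiag d = d i *: row i V.
Proof.
rewrite /udiag !mulmxA -row_mul unitary_mulVt -row_mul mul1mx row_diag_mx mxE.
by rewrite -scalemxAl -rowE.
Qed.

Lemma unitary_row_norm i : row i V *m (row i V)^t* = 1%:M.
Proof.
apply/matrixP => a b; have /matrixP/(_ i i) := unitary_mulVt.
rewrite !mxE !ord1 !eqxx => <-; apply: eq_bigr => j _.
by rewrite !mxE.
Qed.

(** The operator norm of a normal matrix bounds the euclidean norm of its
    rows. *)
Lemma udiag_row_norm_le d (e : C) o : (forall i, `|d i| <= e) ->
  \sum_j `|udiag d o j| ^+ 2 <= e ^+ 2.
Proof.
move=> He.
have e0 : 0 <= e by apply: le_trans (He o).
have -> : \sum_j `|udiag d o j| ^+ 2 = (udiag d *m (udiag d)^t*) o o.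
  by rewrite [RHS]mxE; apply: eq_bigr => j _; rewrite normCK !mxE.
have -> : (udiag d *m (udiag d)^t*) o o = \sum_i `|d i| ^+ 2 * `|V i o| ^+ 2.
  rewrite udiag_star udiagM /udiag [LHS]mxE; apply: eq_bigr => i _.
  by rewrite mul_mx_diag !mxE !normCK mulrAC mulrC [_ * V i o]mulrC.
have E : \sum_i `|V i o| ^+ 2 = 1.
  have /matrixP/(_ o o) := unitary_mulVV; rewrite !mxE eqxx => H; rewrite -[RHS]H.
  by apply: eq_bigr => i _; rewrite !mxE normCK mulrC.
rewrite -[leRHS]mulr1 -E mulr_sumr; apply: ler_sum => i _.
by rewrite ler_wpM2r ?exprn_ge0 // lerXn2r ?nnegrE.
Qed.

End UnitaryDiagonal.

Lemma hermitian_udiag (C : numClosedFieldType) n (A : 'M[C]_n) :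
  A \is hermsymmx -> exists2 V : 'M[C]_n, V \is unitarymx &
    exists2 d, (forall i, d i \is Num.real) & A = udiag V d.
Proof.
move=> hA; have /orthomx_spectralP AE := hermitian_normalmx hA.
have /mxOverP dreal := hermitian_spectral_diag_real hA.
exists (spectralmx A); first exact: spectral_unitarymx.
exists (spectral_diag A 0) => [i|]; first exact: dreal.
rewrite {1}AE invmx_unitary ?spectral_unitarymx // /udiag.
by congr (_ *m diag_mx _ *m _); apply/rowP => i; rewrite mxE.
Qed.

Section RegularRepresentation.
Variables (R : realType) (gT : finGroupType).
Local Open Scope sesquilinear_scope.
Local Notation C := R[i].
Local Notation CG := (galg C gT).
Local Notation normc := Normc.normc.
Implicit Types (f g h : CG) (x y : gT).

Local Notation N := #|gT|.-1.

Fact card_gT_prednK : N.+1 = #|gT|.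
Proof. by rewrite prednK //; apply/card_gt0P; exists 1%g. Qed.

Definition regidx (i : 'I_N.+1) : gT := enum_val (cast_ord card_gT_prednK i).

Lemma regidx_bij : bijective regidx.
Proof.
exists (fun x => cast_ord (esym card_gT_prednK) (enum_rank x)) => x.
  by rewrite /regidx enum_valK cast_ordK.
by rewrite /regidx cast_ordKV enum_rankK.
Qed.

(** Right multiplication in the basis of group elements.  The row of index 1 is the
    coefficient vector, so the representation is injective and norm bounds on
    matrices yield bounds on coefficients. *)
Definition regmx f : 'M[C]_N.+1 :=
  \matrix_(i, j) gcoef f ((regidx i)^-1 * regidx j)%g.

Lemma regmx_additive : {morph regmx : f g / f - g}.
Proof. by move=> f g; apply/matrixP => i j; rewrite !mxE gcoefB. Qed.

Lemma regmx_scalable : scalable regmx.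
Proof. by move=> a f; apply/matrixP => i j; rewrite !mxE gcoefZ. Qed.

Lemma regmxM f g : regmx (f * g) = regmx f *m regmx g.
Proof.
apply/matrixP => i j; rewrite !mxE.
rewrite gcoefM (reindex_inj (mulgI (regidx i)^-1%g)) /=.
rewrite (reindex regidx) /=; last exact: onW_bij regidx_bij.
apply: eq_bigr => k _; rewrite !mxE invMg invgK; congr (_ * gcoef _ _).
by rewrite -mulgA mulKVg.
Qed.

Lemma regmx1 : regmx 1 = 1%:M.
Proof.
apply/matrixP => i j; rewrite !mxE.
by rewrite gcoef1 -eq_mulVg1 (bij_eq regidx_bij).
Qed.

Lemma regmx_multiplicative : monoid_morphism regmx.
Proof. by split=> [|f g]; [exact: regmx1 | exact: regmxM]. Qed.

HB.instance Definition _ :=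
  GRing.isZmodMorphism.Build CG 'M[C]_N.+1 regmx regmx_additive.
HB.instance Definition _ :=
  GRing.isMonoidMorphism.Build CG 'M[C]_N.+1 regmx regmx_multiplicative.
HB.instance Definition _ :=
  GRing.isScalable.Build C CG 'M[C]_N.+1 *:%R regmx regmx_scalable.

Definition regrep : {lrmorphism CG -> 'M[C]_N.+1} := regmx.

Lemma regmx_star f : regmx (gstar f) = (regmx f)^t*.
Proof.
by apply/matrixP => i j; rewrite !mxE gcoef_gstar invMg invgK.
Qed.

Lemma regmx_inj : injective regmx.
Proof.
move=> f g fg; apply: gcoefP => x; have [t tK Kt] := regidx_bij.
have /matrixP/(_ (t 1%g) (t x)) := fg.
by rewrite !mxE !Kt invg1 mul1g.
Qed.

Lemma regrep_star : star_rep regrep.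
Proof.
split=> [x|f]; last exact: regmx_star.
apply/unitarymxP; rewrite /= -regmx_star gstar_gelt -regmxM geltM mulgV.
exact: regmx1.
Qed.

Definition diagonalized_by (V : 'M[C]_N.+1) g (d : 'I_N.+1 -> R) :=
  regmx g = udiag V (fun i => (d i)%:C).

Section Diagonal.
Variable V : 'M[C]_N.+1.
Hypothesis V_unitary : V \is unitarymx.

Lemma diagonalizedD g h d e : diagonalized_by V g d -> diagonalized_by V h e ->
  diagonalized_by V (g + h) (fun i => d i + e i).
Proof.
rewrite /diagonalized_by => Hg Hh; rewrite (rmorphD regrep) /= Hg Hh udiagD.
by congr udiag; apply/funext => i; rewrite (rmorphD (real_complex R)).
Qed.

Lemma diagonalizedM g h d e : diagonalized_by V g d -> diagonalized_by V h e ->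
  diagonalized_by V (g * h) (fun i => d i * e i).
Proof.
rewrite /diagonalized_by => Hg Hh.
rewrite regmxM.
rewrite Hg.
rewrite Hh.
rewrite (udiagM V_unitary).
by congr udiag; apply/funext => i; rewrite (rmorphM (real_complex R)).
Qed.

Lemma diagonalizedC (a : R) : diagonalized_by V (a%:C *: 1) (fun=> a).
Proof.
by rewrite /diagonalized_by udiagC // regmx_scalable regmx1 scalemx1.
Qed.

Lemma eq_diagonalized g d e : d =1 e -> diagonalized_by V g d ->
  diagonalized_by V g e.
Proof. by move=> /funext ->. Qed.

Lemma diagonalizedB g h d e : diagonalized_by V g d -> diagonalized_by V h e ->
  diagonalized_by V (g - h) (fun i => d i - e i).
Proof.
move=> Hg Hh; have := diagonalizedD Hg (diagonalizedM (diagonalizedC (-1)) Hh).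
rewrite (rmorphN1 (real_complex R)) scaleN1r mulN1r; apply: eq_diagonalized => i.
by rewrite mulN1r.
Qed.

Lemma diagonalized_gpeval g d (p : {poly R}) : diagonalized_by V g d ->
  diagonalized_by V (gpeval p g) (fun i => p.[d i]).
Proof.
move=> Hg; elim/poly_ind: p => [|p c IH].
  rewrite -[0]/(0%:P) gpevalC; apply: eq_diagonalized (diagonalizedC 0) => i.
  by rewrite hornerC.
rewrite gpevalD gpevalM gpevalX gpevalC.
apply: eq_diagonalized (diagonalizedD (diagonalizedM IH Hg) (diagonalizedC c)) => i.
by rewrite hornerMXaddC.
Qed.

Lemma diagonalized_spectrum alpha g d : diagonalized_by V g d ->
  spectrum_in alpha g -> forall i, alpha <= d i <= 1.
Proof.
move=> Hg Hs i.
have : eigenvalue (regrep g) (d i)%:C.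
  apply/eigenvalueP; exists (row i V); first by rewrite /= Hg udiag_row.
  apply/eqP => V0; have := unitary_row_norm V_unitary i; rewrite V0 mul0mx.
  by move/matrixP/(_ 0 0)/eqP; rewrite !mxE eqxx eq_sym oner_eq0.
by move/(Hs _ _ regrep_star); rewrite -[1]/((1:R)%:C) !lecR.
Qed.

Lemma diagonalized_nonneg g d : diagonalized_by V g d ->
  gnonneg g -> forall i, 0 <= d i.
Proof.
move=> Hg /(_ _ _ regrep_star)[_ Hp] i; have := Hp (row i V).
rewrite /= Hg udiag_row // -scalemxAl unitary_row_norm // !mxE eqxx mulr1.
by rewrite ler0c.
Qed.

Lemma diagonalized_coef_bound g d e : diagonalized_by V g d ->
  (forall i, `|d i| <= e) -> \sum_x normc (gcoef g x) ^+ 2 <= e ^+ 2.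
Proof.
move=> Hg He; have [t tK Kt] := regidx_bij.
have e0 : 0 <= e by apply: le_trans (He ord0).
have H i : `|(d i)%:C| <= e%:C by rewrite normcE normc_real lecR.
have := udiag_row_norm_le V_unitary (t 1%g) H.
rewrite -Hg -rmorphXn.
have -> : \sum_j `|regmx g (t 1%g) j| ^+ 2 = (\sum_x normc (gcoef g x) ^+ 2)%:C.
  rewrite (rmorph_sum (real_complex R)) /= [RHS](reindex regidx) /=; last first.
    exact: onW_bij regidx_bij.
  by apply: eq_bigr => j _; rewrite normcE mxE Kt invg1 mul1g -rmorphXn.
by rewrite lecR.
Qed.

End Diagonal.

Lemma diagonalizable g : gstar g = g ->
  exists2 V : 'M[C]_N.+1, V \is unitarymx & exists d, diagonalized_by V g d.
Proof.
move=> sg; have hA : regmx g \is hermsymmx.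
  by apply/is_hermitianmxP; rewrite expr0 scale1r -regmx_star sg.
have [V Vu [d dreal AE]] := hermitian_udiag hA.
exists V => //; exists (fun i => complex.Re (d i)).
rewrite /diagonalized_by AE; congr udiag.
by apply/funext => i; rewrite RRe_real.
Qed.

End RegularRepresentation.

(** * Square roots of nonnegative elements *)

Section SquareRoot.
Variables (R : realType) (gT : finGroupType).
Local Open Scope sesquilinear_scope.
Local Notation C := R[i].
Local Notation CG := (galg C gT).
Local Notation normc := Normc.normc.
Implicit Types (f g h : CG) (x y : gT).

Lemma row_norm_ge0 n (u : 'rV[C]_n) : 0 <= (u *m u^t*) 0 0.
Proof.
rewrite mxE; apply: sumr_ge0 => i _; rewrite !mxE -normCK.
by rewrite exprn_ge0.
Qed.

Lemma psdmx_gram m n (A : 'M[C]_(m, n)) : psdmx (A^t* *m A).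
Proof.
split=> [|u].
  by apply/is_hermitianmxP; rewrite expr0 scale1r trmx_mul map_mxM /= trmxCK.
rewrite mulmxA -mulmxA -{2}[A]trmxCK -map_mxM -trmx_mul.
exact: row_norm_ge0.
Qed.

Lemma gnonneg_sqr g : gstar g = g -> gnonneg (g * g).
Proof.
move=> sg n pi [_ piS]; have -> : pi (g * g) = (pi g)^t* *m pi g by rewrite -piS sg rmorphM.
exact: psdmx_gram.
Qed.

(** The square root is obtained as g * g, where g is a polynomial in f that
    interpolates the fourth root at the eigenvalues of the regular
    representation.  Being a hermitian square, it is nonnegative in every
    representation, which spares a comparison of spectra. *)
Lemma gsqrtP (alpha : R) f : 0 <= alpha -> gstar f = f -> spectrum_in alpha f ->
  [/\ gnonneg (gsqrt f), gstar (gsqrt f) = gsqrt f & gsqrt f ^+ 2 = f].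
Proof.
move=> a0 sf spf.
suff : exists h, [/\ gnonneg h, gstar h = h & h ^+ 2 = f] by move/xgetPex; apply.
have [V Vu [d Hd]] := diagonalizable sf.
have dI := diagonalized_spectrum Vu Hd spf.
have [s _ Hs] := interpolation [seq d i | i <- enum 'I_#|gT|.-1.+1]
  (fun t => Num.sqrt (Num.sqrt t)).
pose g := gpeval s f; have sg : gstar g = g by apply: gstar_gpeval.
exists (g * g); split; first exact: gnonneg_sqr.
  by rewrite gstarM sg.
have Hg : diagonalized_by V g (fun i => Num.sqrt (Num.sqrt (d i))).
  apply: eq_diagonalized (diagonalized_gpeval Vu s Hd) => i.
  by rewrite Hs // map_f // mem_enum.
have Hgg := diagonalizedM Vu Hg Hg.
apply: regmx_inj; rewrite [RHS]Hd expr2 (diagonalizedM Vu Hgg Hgg).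
congr udiag; apply/funext => i; congr (_%:C).
have /andP[ad _] := dI i.
by rewrite -!expr2 !sqr_sqrtr ?sqrtr_ge0 // (le_trans a0).
Qed.

Section Approximation.
Variables (alpha : R) (f : CG).
Hypotheses (alpha_ge0 : 0 <= alpha) (f_star : gstar f = f).
Hypothesis f_spec : spectrum_in alpha f.
Variables (p : {poly R}) (e : R).
Hypothesis p_approx : forall t, alpha <= t <= 1 -> `|p.[t] - Num.sqrt t| <= e.

Let diag : exists2 V, V \is unitarymx & exists2 m,
  diagonalized_by V (gsqrt f) m & (forall i, 0 <= m i <= 1) /\
    forall i, `|p.[m i * m i] - m i| <= e.
Proof.
have [h0 hs h2] := gsqrtP alpha_ge0 f_star f_spec.
have [V Vu [m Hm]] := diagonalizable hs.
have m0 := diagonalized_nonneg Vu Hm h0.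
have Hf : diagonalized_by V f (fun i => m i * m i).
  by rewrite -h2 expr2; apply: diagonalizedM.
have mI := diagonalized_spectrum Vu Hf f_spec.
exists V => //; exists m => //; split=> i.
  rewrite m0; have /andP[_] := mI i; rewrite -expr2.
  by rewrite -[1 in X in X -> _](expr1n _ 2) ler_pXn2r ?nnegrE.
by have := p_approx (mI i); rewrite -expr2 sqrtr_sqr (ger0_norm (m0 i)).
Qed.

Lemma gsqrt_gpeval_dist :
  \sum_x normc (gcoef (gsqrt f - gpeval p f) x) ^+ 2 <= e ^+ 2.
Proof.
have [V Vu [m Hm [_ me]]] := diag.
have [_ _ h2] := gsqrtP alpha_ge0 f_star f_spec.
have Hf : diagonalized_by V f (fun i => m i * m i).
  by rewrite -h2 expr2; apply: diagonalizedM.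
apply: (diagonalized_coef_bound Vu (diagonalizedB Vu Hm (diagonalized_gpeval Vu p Hf))).
by move=> i; rewrite distrC.
Qed.

Lemma gpeval_sqr_dist : e <= 1 ->
  \sum_x normc (gcoef (f - gpeval p f * gpeval p f) x) ^+ 2 <= (3 * e) ^+ 2.
Proof.
move=> e1.
have [V Vu [m Hm [m01 me]]] := diag.
have [_ _ h2] := gsqrtP alpha_ge0 f_star f_spec.
have Hf : diagonalized_by V f (fun i => m i * m i).
  by rewrite -h2 expr2; apply: diagonalizedM.
have Hp := diagonalized_gpeval Vu p Hf.
apply: (diagonalized_coef_bound Vu (diagonalizedB Vu Hf (diagonalizedM Vu Hp Hp))).
move=> i; have := me i; have /andP[m0 m1] := m01 i.
set q := p.[_]; set s := m i in m0 m1 *.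
have -> : s * s - q * q = (q + s) * - (q - s) by ring.
rewrite normrM normrN => qe; apply: ler_pM => //.
by move: qe; rewrite !ler_norml; lra.
Qed.

End Approximation.
End SquareRoot.

(** * Sums of hermitian squares supported in a set *)

Section SumOfSquares.
Variables (R : realType) (gT : finGroupType).
Local Open Scope sesquilinear_scope.
Local Notation C := R[i].
Local Notation CG := (galg C gT).
Local Notation normc := Normc.normc.
Variable S : {set gT}.
Local Notation m := #|S|.
Implicit Types (f g h : CG) (x y : gT).

Lemma psdmxD n (A B : 'M[C]_n) : psdmx A -> psdmx B -> psdmx (A + B).
Proof.
move=> [hA pA] [hB pB]; split=> [|u].
  apply/is_hermitianmxP; rewrite expr0 scale1r linearD /= map_mxD.
  move/is_hermitianmxP: hA; move/is_hermitianmxP: hB.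
  by rewrite expr0 !scale1r => <- <-.
by rewrite mulmxDr mulmxDl mxE addr_ge0.
Qed.

Lemma psdmxZ n (a : R) (A : 'M[C]_n) : 0 <= a -> psdmx A -> psdmx (a%:C *: A).
Proof.
move=> a0 [hA pA]; split=> [|u].
  apply/is_hermitianmxP; rewrite expr0 scale1r linearZ /= map_mxZ.
  move/is_hermitianmxP: hA; rewrite expr0 scale1r => {1}->.
  by congr (_ *: _); rewrite -[LHS]conjcR.
by rewrite -scalemxAr -scalemxAl mxE mulr_ge0 // ler0c.
Qed.

Lemma psdmx0 n : psdmx (0 : 'M[C]_n).
Proof.
split=> [|u]; last by rewrite mulmx0 mul0mx mxE.
by apply/is_hermitianmxP; rewrite expr0 scale1r trmx0 map_mx0.
Qed.

Lemma gram_eltD (P Q : 'M[C]_m) : gram_elt (P + Q) = gram_elt P + gram_elt Q.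
Proof.
rewrite /gram_elt -big_split; apply: eq_bigr => i _.
by rewrite -big_split; apply: eq_bigr => j _; rewrite mxE scalerDl.
Qed.

Lemma gram_eltZ (a : C) (Q : 'M[C]_m) : gram_elt (a *: Q) = a *: gram_elt Q.
Proof.
rewrite /gram_elt scaler_sumr; apply: eq_bigr => i _.
by rewrite scaler_sumr; apply: eq_bigr => j _; rewrite mxE scalerA.
Qed.

Definition sos_on g := exists2 Q : 'M[C]_m, psdmx Q & g = gram_elt Q.

Lemma sos_onD g h : sos_on g -> sos_on h -> sos_on (g + h).
Proof.
move=> [P hP ->] [Q hQ ->]; exists (P + Q); first exact: psdmxD.
by rewrite gram_eltD.
Qed.

Lemma sos_onZ (a : R) g : 0 <= a -> sos_on g -> sos_on (a%:C *: g).
Proof.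
move=> a0 [Q hQ ->]; exists (a%:C *: Q); first exact: psdmxZ.
by rewrite gram_eltZ.
Qed.

Lemma sos_on0 : sos_on 0.
Proof.
exists 0; first exact: psdmx0.
by rewrite -[0 in RHS](scale0r 0) gram_eltZ scale0r.
Qed.

Lemma sos_on_sqr g : gsupp g \subset S -> sos_on (gstar g * g).
Proof.
move=> gS; pose a : 'rV[C]_m := \row_i gcoef g (enum_val i).
exists (a^t* *m a); first exact: psdmx_gram.
have gE : g = \sum_(i : 'I_m) gcoef g (enum_val i) *: gelt C (enum_val i).
  rewrite {1}(gelt_sum g) (bigID (mem S)) /= [X in _ + X]big1 => [|x xS].
    by rewrite addr0 big_enum_val.
  rewrite gcoef_notin ?scale0r //; apply: contra xS; exact: fintype.subsetP.
rewrite {1 2}gE gstar_sum big_distrl /=; apply: eq_bigr => i _.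
rewrite big_distrr /=; apply: eq_bigr => j _.
rewrite gstarZ gstar_gelt -scalerAl -scalerAr geltM scalerA.
by rewrite [in RHS]mxE big_ord1 !mxE.
Qed.

Lemma addr_swap (V : nmodType) (o a b : V) :
  o + a + (b + o) = o + o + (a + b).
Proof. by rewrite [b + o]addrC addrACA. Qed.

Lemma scale_half (K : comNzRingType) (V : lmodType K) (t n u u' : K) (o a b : V) :
  t * 2 = 1 ->
  n *: o + t *: ((n * u) *: a + (n * u') *: b) =
  (t * n) *: (2 *: o + (u *: a + u' *: b)).
Proof.
move=> t2; rewrite [RHS]scalerDr [(t * n) *: (2 *: o)]scalerA mulrAC t2 mul1r.
by congr (_ + _); rewrite !scalerDr !scalerA !mulrA.
Qed.

Lemma half_mul2 : 2^-1%:C * 2 = 1 :> C.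
Proof.
by rewrite -(rmorph_nat (real_complex R)) -(rmorphM (real_complex R)) mulVf ?pnatr_eq0.
Qed.

(** The element is |c| / 2 times the hermitian square of y + u z, where
    u = c / |c|. *)
Lemma sos_on_gelt (c : C) y z : y \in S -> z \in S ->
  sos_on ((normc c)%:C *: 1 + 2^-1%:C *:
    (c *: gelt C (y^-1 * z)%g + c^*%R *: gelt C (z^-1 * y)%g)).
Proof.
move=> yS zS; have [->|c0] := eqVneq c 0.
  by rewrite Normc.normc0 conjC0 (rmorph0 (real_complex R)) !scale0r addr0 scaler0 addr0; exact: sos_on0.
have n0 : normc c != 0 by apply: contra c0 => /eqP/Normc.eq0_normc ->.
pose u := (normc c)^-1%:C * c.
have uu : u^*%R * u = 1.
  rewrite mulrC mulc_conj /u Normc.normcM normc_real ger0_norm ?invr_ge0 ?normc_ge0 //.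
  by rewrite mulVf // expr1n.
have cu : c = (normc c)%:C * u by rewrite /u mulrA -rmorphM mulfV // mul1r.
pose g : CG := gelt C y + u *: gelt C z.
have gS : gsupp g \subset S.
  apply/fintype.subsetP => x; rewrite inE gcoefD gcoefZ !gcoef_gelt.
  have [->//|_] := eqVneq x y; have [->//|_] := eqVneq x z.
  by rewrite mulr0 addr0 eqxx.
have := sos_onZ (_ : 0 <= normc c / 2) (sos_on_sqr gS).
rewrite divr_ge0 ?normc_ge0 // => /(_ isT).
have -> : gstar g * g = 2 *: 1 + (u *: gelt C (y^-1 * z)%g + u^*%R *: gelt C (z^-1 * y)%g).
  rewrite /g gstarD gstarZ !gstar_gelt mulrDl !mulrDr -!scalerAl -!scalerAr !geltM.
  rewrite !mulVg scalerA uu scale1r -[gelt C 1%g]/(1 : CG) scaler_nat mulr2n.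
  exact: addr_swap.
have hE : (normc c / 2)%:C = 2^-1%:C * (normc c)%:C.
  by rewrite mulrC -(rmorphM (real_complex R)).
have h2 := half_mul2.
have cuJ : c^*%R = (normc c)%:C * u^*%R.
  by rewrite {1}cu (rmorphM Num.conj); congr (_ * _); exact: conjcR.
by rewrite hE -(scale_half _ _ _ _ _ _ h2) -cu -cuJ.
Qed.

Lemma sos_on_sum I (r : seq I) (P : pred I) (F : I -> CG) :
  (forall i, P i -> sos_on (F i)) -> sos_on (\sum_(i <- r | P i) F i).
Proof. by move=> HF; elim/big_ind: _ => //; [exact: sos_on0 | exact: sos_onD]. Qed.

Lemma sos_on_shift r : gstar r = r -> gsupp r \subset mulg (invg S) S ->
  sos_on (r + (gnorm1 r)%:C *: 1).
Proof.
move=> sr rS; have h2 := half_mul2.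
have rs : \sum_x (gcoef r x)^*%R *: gelt C x^-1%g = r by rewrite -[RHS]sr.
have rr : 2^-1%:C *: (r + r) = r.
  by rewrite -[in LHS](scale1r r) -scalerDl scalerA -[1 + 1]/(2 : C) h2 scale1r.
have -> : r + (gnorm1 r)%:C *: 1 = \sum_x ((normc (gcoef r x))%:C *: 1 + 2^-1%:C *:
    (gcoef r x *: gelt C x + (gcoef r x)^*%R *: gelt C x^-1%g)).
  rewrite big_split /= -scaler_suml -scaler_sumr big_split /=.
  rewrite -gelt_sum rs rr.
  by rewrite addrC; congr (_ + _); rewrite /gnorm1 (rmorph_sum (real_complex R)).
apply: sos_on_sum => x _; have [xr|xr] := boolP (x \in gsupp r).
  have /mulsgP[y z] := fintype.subsetP rS x xr.
  rewrite mem_invg => yS zS ->.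
  by have := sos_on_gelt (gcoef r (y * z)%g) yS zS; rewrite invgK invMg.
rewrite gcoef_notin // Normc.normc0 conjC0 (rmorph0 (real_complex R)) !scale0r addr0.
by rewrite scaler0 addr0; exact: sos_on0.
Qed.

(** Any hermitian square supported in S yields an admissible shift, the
    coefficient norm of what it leaves of f. *)
Lemma sos_shift_residual f g : gstar f = f -> 1%g \in S -> gsupp f \subset S ->
  gsupp g \subset S -> sos_shift S f (gnorm1 (f - gstar g * g)).
Proof.
move=> sf S1 fS gS; split; first exact: gnorm1_ge0.
suff : sos_on (f + (gnorm1 (f - gstar g * g))%:C *: 1) by [].
set r := f - gstar g * g.
have -> : f = r + gstar g * g by rewrite subrK.
rewrite addrAC; apply: sos_onD; last exact: sos_on_sqr.
apply: sos_on_shift; first by rewrite gstarB gstarM gstarK sf.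
apply: fintype.subset_trans (gsuppD _ _) _; rewrite finset.subUset gsuppN; apply/andP; split.
  apply: fintype.subset_trans fS _; apply/fintype.subsetP => x xS; apply/mulsgP.
  by exists 1%g x; rewrite ?mul1g // mem_invg invg1.
apply: fintype.subset_trans (gsuppM _ _) _; apply: mulgSS => //.
apply/fintype.subsetP => x; rewrite mem_invg !inE gcoef_gstar conjC_eq0 => xg.
by apply: (fintype.subsetP gS); rewrite inE.
Qed.

End SumOfSquares.

(** * Existence of the minimal shift *)

Section LipschitzComplex.
Local Open Scope classical_set_scope.
Variables (R : realType) (n : nat).
Local Notation C := R[i].
Local Notation normc := Normc.normc.
Implicit Types (F G : 'rV[R]_n -> C).

(** Closedness of the constraints on a Gram matrix is proved through this
    property, which is visibly stable under the operations that build them. *)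
Definition lipschitzC F := exists K : R, forall u v,
  normc (F u - F v) <= \sum_i K * `|u 0 i - v 0 i|.

Lemma lipschitzC_cst (c : C) : lipschitzC (fun=> c).
Proof.
exists 0 => u v; rewrite subrr Normc.normc0; apply: sumr_ge0 => i _.
by rewrite mul0r.
Qed.

Lemma lipschitzC_coord k : lipschitzC (fun v => (v 0 k)%:C).
Proof.
exists 1 => u v; rewrite -(rmorphB (real_complex R)) normc_real (bigD1 k) //= mul1r lerDl.
by apply: sumr_ge0 => i _; rewrite mul1r.
Qed.

Lemma lipschitzCD F G : lipschitzC F -> lipschitzC G ->
  lipschitzC (fun v => F v + G v).
Proof.
move=> [K HF] [L HG]; exists (K + L) => u v.
under eq_bigr do rewrite mulrDl.
by rewrite big_split opprD addrACA (le_trans (le_normcD _ _)) // lerD.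
Qed.

Lemma lipschitzCZ (c : C) F : lipschitzC F -> lipschitzC (fun v => c * F v).
Proof.
move=> [K HF]; exists (normc c * K) => u v.
rewrite -mulrBr Normc.normcM; under eq_bigr do rewrite -mulrA.
by rewrite -mulr_sumr ler_wpM2l ?normc_ge0.
Qed.

Lemma lipschitzC_conj F : lipschitzC F -> lipschitzC (fun v => (F v)^*%R).
Proof.
by move=> [K HF]; exists K => u v; rewrite -(rmorphB Num.conj) normc_conj.
Qed.

Lemma lipschitzC_sum I (r : seq I) (P : pred I) (F : I -> 'rV[R]_n -> C) :
  (forall i, lipschitzC (F i)) ->
  lipschitzC (fun v => \sum_(i <- r | P i) F i v).
Proof.
move=> HF; elim: r => [|i r IH].
  have -> : (fun v => \sum_(i <- [::] | P i) F i v) = fun=> 0.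
    by apply/funext => v; rewrite big_nil.
  exact: lipschitzC_cst.
have -> : (fun v => \sum_(i <- i :: r | P i) F i v) =
   fun v => (P i)%:R * F i v + \sum_(i <- r | P i) F i v.
  by apply/funext => v; rewrite big_cons; case: (P i); rewrite ?mul1r ?mul0r ?add0r.
by apply: lipschitzCD IH; exact: lipschitzCZ.
Qed.

Lemma lipschitzC_continuous F : lipschitzC F -> continuous (fun v => complex.Re (F v)).
Proof.
move=> [K HF]; apply: (@rV_lipschitz_continuous _ _ _ (fun=> K)) => u v.
apply: le_trans (HF u v); rewrite -lecR -normcE.
have := normc_ge_Re (F u - F v).
by case: (F u) => a b; case: (F v).
Qed.

Lemma lipschitzC_closed_ge0 F : lipschitzC F -> closed [set v | 0 <= F v].
Proof.
move=> HF; have HG := lipschitzCZ 'i HF.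
have -> : [set v | 0 <= F v] =
    (fun v => complex.Re (F v)) @^-1` [set x | 0 <= x] `&`
    (fun v => complex.Re ('i%C * F v)) @^-1` [set x | x = 0].
  apply/seteqP; split=> v /=; rewrite lecE mulrC ReiNIm => /=.
    by move=> /andP[/eqP -> ->]; rewrite oppr0.
  by move=> [-> /eqP]; rewrite oppr_eq0 => ->.
apply: closedI.
  by move/continuous_closedP: (lipschitzC_continuous HF); apply; exact: closed_ge.
by move/continuous_closedP: (lipschitzC_continuous HG); apply; exact: closed_eq.
Qed.

Lemma lipschitzC_closed_eq0 F : lipschitzC F -> closed [set v | F v = 0].
Proof.
move=> HF; have HG := lipschitzCZ (-1) HF.
have -> : [set v | F v = 0] = [set v | 0 <= F v] `&` [set v | 0 <= -1 * F v].
  apply/seteqP; split=> v /=; first by move=> ->; rewrite mulr0 lexx.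
  by rewrite mulN1r oppr_ge0 => -[h1 h2]; apply/eqP; rewrite eq_le h1 h2.
by apply: closedI; exact: lipschitzC_closed_ge0.
Qed.

End LipschitzComplex.

Section MinimumExists.
Local Open Scope classical_set_scope.
Local Open Scope sesquilinear_scope.
Variables (R : realType) (gT : finGroupType).
Local Notation C := R[i].
Local Notation CG := (galg C gT).
Local Notation normc := Normc.normc.

Lemma Re_le_normc (z : C) : `|complex.Re z| <= normc z.
Proof.
by case: z => a b /=; rewrite -sqrtr_sqr ler_wsqrtr // lerDl sqr_ge0.
Qed.

Lemma Im_le_normc (z : C) : `|complex.Im z| <= normc z.
Proof.
by case: z => a b /=; rewrite -sqrtr_sqr ler_wsqrtr // lerDr sqr_ge0.
Qed.

Lemma psdmx_trace_ge0 n (Q : 'M[C]_n) : psdmx Q -> 0 <= \tr Q.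
Proof.
move=> [_ pQ]; apply: sumr_ge0 => i _; have := pQ (delta_mx 0 i).
by rewrite -rowE trmx_delta map_delta_mx -colE !mxE.
Qed.

(** The eigenvalues are nonnegative, hence at most their sum, and they bound the
    norm of each row. *)
Lemma psdmx_entry_le n (Q : 'M[C]_n) i j : psdmx Q -> `|Q i j| <= \tr Q.
Proof.
move=> [/hermitian_udiag[V Vu [d _ QE]] pQ].
have d0 k : 0 <= d k.
  have := pQ (row k V).
  by rewrite QE udiag_row // -scalemxAl mxE unitary_row_norm // mxE eqxx mulr1.
have trE : \tr Q = \sum_k d k.
  rewrite QE /udiag mxtrace_mulC mulmxA unitary_mulVt // mul1mx mxtrace_diag.
  by apply: eq_bigr => k _; rewrite mxE.
have tr0 : 0 <= \tr Q by rewrite trE; apply: sumr_ge0.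
have dk k : `|d k| <= \tr Q.
  by rewrite ger0_norm // trE (bigD1 k) //= lerDl sumr_ge0.
rewrite -ler_sqr ?nnegrE //.
apply: le_trans (udiag_row_norm_le Vu i dk).
by rewrite -QE (bigD1 j) //= lerDl sumr_ge0 // => k _; rewrite exprn_ge0.
Qed.

Variables (S : {set gT}) (f : CG).
Local Notation m := #|S|.

Lemma gcoef_gram1 (Q : 'M[C]_m) : gcoef (gram_elt Q) 1%g = \tr Q.
Proof.
rewrite /gram_elt gcoef_sum; apply: eq_bigr => i _.
rewrite gcoef_sum (bigD1 i) //= big1 => [|j ji].
  by rewrite gcoefZ gcoef_gelt mulVg eqxx mulr1 addr0.
rewrite gcoefZ gcoef_gelt eq_sym -eq_mulVg1 (inj_eq enum_val_inj).
by rewrite eq_sym (negPf ji) mulr0.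
Qed.

Local Notation N := #|{: 'I_m * 'I_m * bool}|.

(** Complex matrices are encoded as real row vectors, for which closed boxes are
    compact; the boolean selects the imaginary part. *)
Definition realmx_vec (v : 'rV[R]_N) : 'M[C]_m :=
  \matrix_(i, j) (v 0 (enum_rank (i, j, false)) +i* v 0 (enum_rank (i, j, true))).

Definition vec_realmx (Q : 'M[C]_m) : 'rV[R]_N :=
  \row_k let: (i, j, b) := enum_val k in
    if b then complex.Im (Q i j) else complex.Re (Q i j).

Lemma vec_realmxK Q : realmx_vec (vec_realmx Q) = Q.
Proof.
by apply/matrixP => i j; rewrite !mxE !enum_rankK /=; case: (Q i j).
Qed.

Lemma lipschitzC_entry i j : lipschitzC (fun v => realmx_vec v i j).
Proof.
have -> : (fun v => realmx_vec v i j) = fun v =>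
   (v 0 (enum_rank (i, j, false)))%:C + 'i%C * (v 0 (enum_rank (i, j, true)))%:C.
  by apply/funext => v; rewrite mxE [LHS]complexE.
by apply: lipschitzCD; [|apply: lipschitzCZ]; exact: lipschitzC_coord.
Qed.

Lemma lipschitzC_gram x : lipschitzC (fun v => gcoef (gram_elt (realmx_vec v)) x).
Proof.
have -> : (fun v => gcoef (gram_elt (realmx_vec v)) x) = fun v =>
   \sum_i \sum_j gcoef (gelt C ((enum_val i)^-1 * enum_val j)%g) x * realmx_vec v i j.
  apply/funext => v; rewrite gcoef_sum; apply: eq_bigr => i _.
  by rewrite gcoef_sum; apply: eq_bigr => j _; rewrite gcoefZ mulrC.
apply: lipschitzC_sum => i; apply: lipschitzC_sum => j.
exact/lipschitzCZ/lipschitzC_entry.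
Qed.

Lemma closed_psdmx : closed [set v | psdmx (realmx_vec v)].
Proof.
have -> : [set v | psdmx (realmx_vec v)] =
    (\bigcap_(ij in [set: 'I_m * 'I_m]) [set v |
       realmx_vec v ij.1 ij.2 + -1 * (realmx_vec v ij.2 ij.1)^*%R = 0]) `&`
    (\bigcap_(u in [set: 'rV[C]_m]) [set v |
       0 <= \sum_j \sum_i ((u 0 j)^*%R * u 0 i) * realmx_vec v i j]).
  have quadE v (u : 'rV[C]_m) : (u *m realmx_vec v *m u^t*) 0 0 =
      \sum_j \sum_i ((u 0 j)^*%R * u 0 i) * realmx_vec v i j.
    rewrite mxE; apply: eq_bigr => j _; rewrite mxE mulr_suml.
    by apply: eq_bigr => i _; rewrite !mxE; ring.
  apply/seteqP; split=> v /=.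
    move=> [/is_hermitianmxP hv pv]; split=> [[i j] _ /=|u _ /=]; last by rewrite -quadE.
    rewrite {1}hv expr0 scale1r !mxE mulN1r; exact: subrr.
  move=> [hv pv]; split=> [|u]; last by rewrite quadE; exact: pv.
  apply/is_hermitianmxP; rewrite expr0 scale1r; apply/matrixP => i j.
  have := hv (i, j) I; rewrite /= mulN1r => /eqP; rewrite subr_eq0 => /eqP ->.
  by rewrite !mxE.
apply: closedI.
  apply: closed_bigI => -[i j] _; apply: lipschitzC_closed_eq0.
  apply: lipschitzCD; first exact: lipschitzC_entry.
  exact/lipschitzCZ/lipschitzC_conj/lipschitzC_entry.
apply: closed_bigI => u _; apply: lipschitzC_closed_ge0; apply: lipschitzC_sum => j; apply: lipschitzC_sum => i.
exact/lipschitzCZ/lipschitzC_entry.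
Qed.

(** The shift is determined by the Gram matrix: comparing the coefficients of 1
    gives lambda = tr Q - C_f(1). *)
Definition trace_shift (v : 'rV[R]_N) : R :=
  complex.Re (gcoef (gram_elt (realmx_vec v)) 1%g + - gcoef f 1%g).

Lemma lipschitzC_trace : lipschitzC (fun v =>
  gcoef (gram_elt (realmx_vec v)) 1%g + - gcoef f 1%g).
Proof. by apply: lipschitzCD; [exact: lipschitzC_gram | exact: lipschitzC_cst]. Qed.

Lemma sos_shift_min : sos_shift S f !=set0 -> exists l, is_min (sos_shift S f) l.
Proof.
have shiftE l (Q : 'M[C]_m) : f + l%:C *: 1 = gram_elt Q -> gcoef (gram_elt Q) 1%g - gcoef f 1%g = l%:C.
  by move=> <-; rewrite gcoefD gcoefZ gcoef1 eqxx mulr1 addrAC subrr add0r.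
move=> [l0 [l00 [Q0 pQ0 fQ0]]].
pose D := [set v | psdmx (realmx_vec v)] `&`
  ([set v | 0 <= gcoef (gram_elt (realmx_vec v)) 1%g + - gcoef f 1%g] `&`
   \bigcap_(x in [set: gT]) [set v |
     gcoef f x + ((x == 1%g)%:R * (gcoef (gram_elt (realmx_vec v)) 1%g + - gcoef f 1%g)
       + -1 * gcoef (gram_elt (realmx_vec v)) x) = 0]).
have cD : closed D.
  apply: closedI closed_psdmx _; apply: closedI.
    exact: lipschitzC_closed_ge0 lipschitzC_trace.
  apply: closed_bigI => x _; apply: lipschitzC_closed_eq0.
  apply: lipschitzCD; first exact: lipschitzC_cst.
  apply: lipschitzCD; first exact: lipschitzCZ lipschitzC_trace.
  exact/lipschitzCZ/lipschitzC_gram.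
have DE v : D v -> sos_shift S f (trace_shift v).
  move=> [pv [l_ge0 hv]].
  have lE : (trace_shift v)%:C = gcoef (gram_elt (realmx_vec v)) 1%g + - gcoef f 1%g.
    by rewrite /trace_shift RRe_real // ger0_real.
  split; first by rewrite -ler0c lE.
  exists (realmx_vec v) => //; apply: gcoefP => x; rewrite gcoefD gcoefZ gcoef1 lE.
  have := hv x I; rewrite /= mulN1r addrA => /eqP; rewrite subr_eq0 => /eqP <-.
  by congr (_ + _); exact: mulrC.
(* Gram matrices of a shift at most l0 have trace at most B. *)
pose B := complex.Re (l0%:C + gcoef f 1%g).
have inD l (Q : 'M[C]_m) : l <= l0 -> 0 <= l -> psdmx Q -> f + l%:C *: 1 = gram_elt Q ->
   ((forall i, `|vec_realmx Q 0 i| <= B) /\ D (vec_realmx Q)) /\ trace_shift (vec_realmx Q) = l.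
  move=> ll0 l_ge0 pQ fQ; have tE := shiftE _ _ fQ.
  split; last by rewrite /trace_shift vec_realmxK tE.
  have trB : \tr Q = (complex.Re (\tr Q))%:C.
    by rewrite RRe_real // ger0_real // psdmx_trace_ge0.
  split.
    move=> k; rewrite mxE; case: (enum_val k) => [[i j] b].
    have : normc (Q i j) <= B.
      rewrite -lecR -normcE (le_trans (psdmx_entry_le i j pQ)) // trB lecR /B.
      have -> : \tr Q = l%:C + gcoef f 1%g by rewrite -gcoef_gram1 -tE subrK.
      by case: (gcoef f 1%g) => a1 b1 /=; rewrite lerD2r.
    apply: le_trans; case: b; first exact: Im_le_normc.
    exact: Re_le_normc.
  split=> /=; rewrite vec_realmxK //; split; first by rewrite tE ler0c.
  move=> x _ /=; rewrite vec_realmxK tE mulN1r -fQ gcoefD gcoefZ gcoef1 addrA [l%:C * _]mulrC.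
  exact: subrr.
have cE : continuous trace_shift by exact: lipschitzC_continuous lipschitzC_trace.
have [box0 _] := inD _ _ (lexx l0) l00 pQ0 fQ0.
have [u [_ Du] umin] := box_min (B := B) cE cD (ex_intro _ _ box0).
exists (trace_shift u); split; first exact: DE.
move=> l [l_ge0 [Q pQ fQ]].
have [[bQ _] tQ0] := inD _ _ (lexx l0) l00 pQ0 fQ0.
have [ll0|/ltW] := leP l l0.
  by have [boxQ <-] := inD _ _ ll0 l_ge0 pQ fQ; exact: umin.
by apply: le_trans; rewrite -tQ0; apply: umin.
Qed.

End MinimumExists.

(** * The two upper bounds on the shift *)

Section Supports.
Variables (R : realType) (gT : finGroupType).
Local Notation C := R[i].
Local Notation CG := (galg C gT).
Local Notation normc := Normc.normc.
Implicit Types (f g h : CG) (F S : {set gT}).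

Lemma leq_card_mulg F S : (#|mulg F S| <= #|F| * #|S|)%N.
Proof.
have -> : mulg F S = (fun u => u.1 * u.2)%g @: finset.setX F S.
  apply/setP => x; apply/mulsgP/imsetP => [[y z yF zS ->]|[[y z]]].
    by exists (y, z); rewrite // inE yF zS.
  by rewrite inE => /andP[/= yF zS] ->; exists y z.
by rewrite -cardsX leq_imset_card.
Qed.

Lemma leq_card_expg F n : (#|(F ^+ n)%g| <= #|F| ^ n)%N.
Proof.
elim: n => [|n IH]; first by rewrite expg0 cards1 expn0.
by rewrite expgS expnS (leq_trans (leq_card_mulg _ _)) // leq_mul2l IH orbT.
Qed.

Lemma mem1_expg F n : 1%g \in F -> 1%g \in (F ^+ n)%g.
Proof.
move=> F1; elim: n => [|n IH]; first by rewrite expg0 set11.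
by rewrite expgS; apply/mulsgP; exists 1%g 1%g; rewrite ?mulg1.
Qed.

Lemma expg_subset F m n : 1%g \in F -> (m <= n)%N ->
  (F ^+ m)%g \subset (F ^+ n)%g.
Proof.
move=> F1 /subnK <-; rewrite expgnDr.
apply/fintype.subsetP => x xF; apply/mulsgP.
by exists 1%g x; rewrite ?mul1g // mem1_expg.
Qed.

(** Shorter words are padded with 1, whence the assumption that it belongs to
    the support. *)
Lemma gsupp_gpeval (p : {poly R}) f n : 1%g \in gsupp f -> (size p <= n.+1)%N ->
  gsupp (gpeval p f) \subset (gsupp f ^+ n)%g.
Proof.
move=> f1; have suppC (c : R) m : gsupp (c%:C *: 1 : CG) \subset (gsupp f ^+ m)%g.
  apply: fintype.subset_trans (gsuppZ _ _) _.
  by rewrite gsupp1 finset.sub1set mem1_expg.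
elim/poly_ind: p n => [|q c IH] n.
  by move=> _; rewrite -[0]/(0%:P) gpevalC.
rewrite size_MXaddC gpevalD gpevalM gpevalX gpevalC.
have [/andP[/eqP -> _] _|_] := ifP.
  by rewrite -[X in gpeval X]/(0%:P) gpevalC scale0r mul0r add0r.
rewrite ltnS => sq; apply: fintype.subset_trans (gsuppD _ _) _.
rewrite finset.subUset suppC andbT; case: n sq => [|n sq].
  rewrite leqn0 size_poly_eq0 => /eqP ->.
  by rewrite -[X in gpeval X]/(0%:P) gpevalC scale0r mul0r -(scale0r 1) suppC.
by rewrite expgSr; apply: fintype.subset_trans (gsuppM _ _) _; apply: mulgSS => //; exact: IH.
Qed.

Lemma sum_le_sqrt_card (T : finType) (A : {set T}) (a : T -> R) (M e : R) :
  0 <= M -> 0 <= e -> (#|A|%:R <= M ^+ 2) -> \sum_x a x ^+ 2 <= e ^+ 2 ->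
  (forall x, x \notin A -> a x = 0) -> \sum_x a x <= M * e.
Proof.
move=> M0 e0 AM ae aA.
have sE : \sum_x a x = \sum_(x in A) a x.
  rewrite (bigID (mem A)) /= [X in _ + X]big1 ?addr0 // => x; exact: aA.
have sqs : (\sum_(x in A) a x) ^+ 2 <= #|A|%:R * \sum_(x in A) a x ^+ 2.
  have -> : (\sum_(x in A) a x) ^+ 2 = \sum_(x in A) \sum_(y in A) a x * a y.
    by rewrite expr2 mulr_suml; apply: eq_bigr => x _; rewrite mulr_sumr.
  apply: (le_trans (y := \sum_(x in A) \sum_(y in A) (a x ^+ 2 + a y ^+ 2) / 2)).
    apply: ler_sum => x _; apply: ler_sum => y _.
    by have := sqr_ge0 (a x - a y); rewrite sqrrB; lra.
  set Q := \sum_(x in A) a x ^+ 2.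
  have inner x : \sum_(y in A) (a x ^+ 2 + a y ^+ 2) / 2 = (#|A|%:R * a x ^+ 2 + Q) / 2.
    by rewrite -mulr_suml big_split /= sumr_const -[_ *+ _]mulr_natl.
  under eq_bigr do rewrite inner.
  by rewrite -mulr_suml big_split /= -mulr_sumr sumr_const -[Q *+ _]mulr_natl -/Q; lra.
have se : \sum_(x in A) a x ^+ 2 <= e ^+ 2.
  apply: le_trans ae; rewrite [leRHS](bigID (mem A)) /= lerDl.
  by apply: sumr_ge0 => x _; exact: sqr_ge0.
rewrite sE (le_trans (ler_norm _)) // -ler_sqr ?nnegrE ?mulr_ge0 //.
rewrite real_normK ?num_real // (le_trans sqs) // exprMn ler_pM //.
by apply: sumr_ge0 => x _; exact: sqr_ge0.
Qed.

Definition gres F g : CG :=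
  [ffun x => if x \in F then gcoef g x else 0].

Lemma gcoef_gres F g x :
  gcoef (gres F g) x = if x \in F then gcoef g x else 0.
Proof. by rewrite /gcoef ffunE. Qed.

End Supports.

Section ErrorBound.
Variables (R : realType) (gT : finGroupType) (alpha : R).
Local Notation C := R[i].
Local Notation CG := (galg C gT).
Local Notation normc := Normc.normc.
Hypothesis alpha01 : 0 <= alpha < 1.
Variables (f : CG) (d : nat).
Hypotheses (f_star : gstar f = f) (f_spec : spectrum_in alpha f) (d_gt0 : (0 < d)%N).

Let S := supp_upto alpha f d.
Let p := best_sqrt_approx alpha d.
Let e := sqrt_err alpha p.
Let h := gsqrt f.

Let alpha_ge0 : 0 <= alpha. Proof. by case/andP: alpha01. Qed.

Let e_ge0 : 0 <= e. Proof. exact: sqrt_err_ge0. Qed.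

Let p_approx t : alpha <= t <= 1 -> `|p.[t] - Num.sqrt t| <= e.
Proof. exact: sqrt_err_ub. Qed.

Lemma gsupp_supp_upto k : (k <= d)%N ->
  gsupp (gpeval (best_sqrt_approx alpha k) f) \subset S.
Proof.
move=> kd; rewrite /S /supp_upto.
have kd' : (k < d.+1)%N by rewrite ltnS.
exact: (finset.bigcup_sup (Ordinal kd')).
Qed.

Lemma supp_upto1 : 1%g \in S.
Proof.
apply: (fintype.subsetP (gsupp_supp_upto (leq0n d))).
have [sp _] := best_sqrt_approxP alpha01 0.
have := best_sqrt_approx0_neq0 alpha01.
rewrite (size1_polyC sp) polyC_eq0 => c0.
by rewrite gpevalC inE gcoefZ gcoef1 eqxx mulr1 (fmorph_eq0 (real_complex R)).
Qed.

Lemma gsupp_sub_supp_upto : gsupp f \subset S.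
Proof.
apply/fintype.subsetP => x xf; have [->|x1] := eqVneq x 1%g; first exact: supp_upto1.
apply: (fintype.subsetP (gsupp_supp_upto d_gt0)).
have sp := size_best_sqrt_approx1 alpha01.
have : lead_coef (best_sqrt_approx alpha 1) != 0.
  by rewrite lead_coef_eq0 -size_poly_eq0 sp.
rewrite lead_coefE sp /= => b0.
set q := best_sqrt_approx alpha 1 in sp b0 *.
have -> : q = (q`_1)%:P * 'X + (q`_0)%:P.
  apply/polyP => i; rewrite coefD coefCM coefX coefC.
  case: i => [|[|i]] /=; rewrite ?mulr0 ?mulr1 ?add0r ?addr0 //.
  by rewrite nth_default // sp.
rewrite gpevalD gpevalM gpevalX !gpevalC inE gcoefD -scalerAl mul1r !gcoefZ gcoef1.
rewrite (negPf x1) mulr0 addr0 mulf_neq0 ?(fmorph_eq0 (real_complex R)) //.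
by rewrite inE in xf.
Qed.

Let hP : [/\ gnonneg h, gstar h = h & h ^+ 2 = f].
Proof. exact: gsqrtP alpha_ge0 f_star f_spec. Qed.

Lemma gsqrt_tail_le : gnorm1 (h - gres S h) <= (#|gT|%:R - #|S|%:R) * e.
Proof.
have -> : #|gT|%:R - #|S|%:R = #|~: S|%:R :> R.
  by rewrite -(cardsC S) natrD addrAC subrr add0r.
rewrite /gnorm1 (bigID (mem S)) /= big1 ?add0r => [|x xS]; last first.
  by rewrite gcoefB gcoef_gres xS subrr Normc.normc0.
rewrite mulr_natl -sumr_const.
under [leRHS]eq_bigl do rewrite inE.
apply: ler_sum => x xS; rewrite gcoefB gcoef_gres (negPf xS) subr0.
have := gsqrt_gpeval_dist alpha_ge0 f_star f_spec p_approx.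
rewrite (bigD1 x) //= gcoefB [gcoef (gpeval _ _) x]gcoef_notin; last first.
  by apply: contra xS; apply: fintype.subsetP; exact: gsupp_supp_upto.
rewrite subr0 => H; rewrite -ler_sqr ?nnegrE ?normc_ge0 //.
by apply: le_trans H; rewrite lerDl; apply: sumr_ge0 => y _; exact: sqr_ge0.
Qed.

(** With g the restriction of h to S, the residual is
    (h - g)^* h + g^* (h - g), and |h - g|_1 is at most e (|G| - |S|). *)
Lemma sos_shift_tail : exists2 l, sos_shift S f l &
  l <= e * (2 * gnorm1 h * (#|gT|%:R - #|S|%:R)).
Proof.
have [_ hs h2] := hP; pose g := gres S h.
exists (gnorm1 (f - gstar g * g)).
  apply: sos_shift_residual f_star supp_upto1 gsupp_sub_supp_upto _.
  by apply/fintype.subsetP => x; rewrite inE gcoef_gres; case: ifP; rewrite ?eqxx.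
have gh : gnorm1 g <= gnorm1 h.
  apply: ler_sum => x _; rewrite gcoef_gres; case: ifP => // _.
  by rewrite Normc.normc0 normc_ge0.
have -> : f - gstar g * g = gstar (h - g) * h + gstar g * (h - g).
  by rewrite gstarB hs mulrBl mulrBr addrA subrK -expr2 h2.
rewrite (le_trans (gnorm1D _ _)) //.
have l1 : gnorm1 (gstar (h - g) * h) <= gnorm1 (h - g) * gnorm1 h.
  by apply: le_trans (gnorm1M _ _) _; rewrite gnorm1_gstar.
have l2 : gnorm1 (gstar g * (h - g)) <= gnorm1 g * gnorm1 (h - g).
  by apply: le_trans (gnorm1M _ _) _; rewrite gnorm1_gstar.
have t0 := gnorm1_ge0 (h - g); have tl := gsqrt_tail_le.
have h0 := gnorm1_ge0 h; rewrite -/g in tl.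
have : gnorm1 g * gnorm1 (h - g) <= gnorm1 h * gnorm1 (h - g) by rewrite ler_wpM2r.
have : gnorm1 h * gnorm1 (h - g) <= gnorm1 h * ((#|gT|%:R - #|S|%:R) * e).
  by rewrite ler_wpM2l.
lra.
Qed.

(** The coefficient of 1 in f = h^* h is the squared euclidean norm of the
    coefficients of h. *)
Lemma gsqrt_eq0 : 1%g \notin gsupp f -> h = 0.
Proof.
move=> /gcoef_notin f1; have [_ hs h2] := hP.
have E : \sum_y normc (gcoef h y) ^+ 2 = 0.
  apply: (@complexI R); rewrite (rmorph_sum (real_complex R)) /= -[RHS]f1 -h2 expr2 gcoefM.
  apply: eq_bigr => y _; rewrite mulg1.
  have -> : gcoef h y^-1%g = (gcoef h y)^*%R by rewrite -{1}hs gcoef_gstar invgK.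
  by rewrite mulc_conj.
apply: gcoefP => x; rewrite gcoef0; apply: Normc.eq0_normc; apply/eqP.
rewrite -sqrf_eq0; apply/eqP.
move/psumr_eq0P: E => -> // y _; exact: sqr_ge0.
Qed.

(** The residual f - p(f)^2 is supported in products of 2 d elements of the
    support of f, and the euclidean norm of its coefficients is at most 3 e. *)
Lemma sos_shift_words : exists2 l, sos_shift S f l &
  l <= e * (3 * #|gsupp f|%:R ^+ d).
Proof.
have [f1|f1] := boolP (1%g \in gsupp f); last first.
  (* Here f = 0, and the other bound already vanishes. *)
  have [l Hl ll] := sos_shift_tail; exists l => //; apply: le_trans ll _.
  have -> : gnorm1 h = 0.
    rewrite (gsqrt_eq0 f1) /gnorm1 big1 // => x _.
    by rewrite gcoef0 Normc.normc0.
  by rewrite mulr0 mul0r mulr0 !mulr_ge0 ?exprn_ge0.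
have [sp _] := best_sqrt_approxP alpha01 d.
pose g := gpeval p f; have gs : gstar g = g by exact: gstar_gpeval.
exists (gnorm1 (f - gstar g * g)).
  apply: sos_shift_residual f_star supp_upto1 gsupp_sub_supp_upto _.
  exact: gsupp_supp_upto.
rewrite gs.
have e1 : e <= 1 by exact: best_sqrt_approx_err_le1.
have bound := gpeval_sqr_dist alpha_ge0 f_star f_spec p_approx e1.
rewrite (_ : e * _ = #|gsupp f|%:R ^+ d * (3 * e)); last by ring.
apply: (@sum_le_sqrt_card _ _ ((gsupp f ^+ (d + d))%g) _ _ _ _ _ _ bound).
- by rewrite exprn_ge0.
- by rewrite mulr_ge0.
- by rewrite -exprM muln2 -addnn -natrX ler_nat leq_card_expg.
move=> x xN; rewrite gcoef_notin ?Normc.normc0 //; apply: contra xN.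
apply: fintype.subsetP; apply: fintype.subset_trans (gsuppD _ _) _.
rewrite finset.subUset gsuppN; apply/andP; split.
  by rewrite -{1}[gsupp f]expg1 expg_subset // addn_gt0 d_gt0.
rewrite expgnDr; apply: fintype.subset_trans (gsuppM _ _) _.
by apply: mulgSS; exact: gsupp_gpeval.
Qed.

Lemma sos_shift_min_le : exists2 delta, is_min (sos_shift S f) delta &
  0 <= sos_beta alpha f d /\ delta <= e * sos_beta alpha f d.
Proof.
have [l1 Hl1 l1b] := sos_shift_tail; have [l2 Hl2 l2b] := sos_shift_words.
have [|delta [D1 D2]] := @sos_shift_min _ _ S f; first by exists l1.
exists delta; first by [].
have {l1b} l1b := le_trans (D2 _ Hl1) l1b; have {l2b} l2b := le_trans (D2 _ Hl2) l2b.
rewrite /sos_beta -/S -/h; split.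
  rewrite le_min !mulr_ge0 ?exprn_ge0 ?gnorm1_ge0 //.
  by rewrite subr_ge0 ler_nat max_card.
by case: (leP (2 * _ * _)).
Qed.

End ErrorBound.

(** * The theorem *)

Lemma geometric_decay (R : realType) (r : R) d : 0 <= r -> r < 1 ->
  d%:R * r ^+ d <= (1 - r)^-1.
Proof.
move=> r0 r1; have r10 : 0 < 1 - r by rewrite subr_gt0.
suff H : d%:R * (1 - r) * r ^+ d <= 1 - r ^+ d.
  rewrite -[leRHS]mul1r ler_pdivlMr // mulrAC.
  by apply: le_trans H _; rewrite gerBl exprn_ge0.
elim: d => [|d IH]; first by rewrite !mul0r expr0 subrr.
have rd : 0 <= r ^+ d by rewrite exprn_ge0.
have rd1 : r ^+ d <= 1 by rewrite exprn_ile1 // ltW.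
rewrite -natr1 exprS; have := ler_wpM2l r0 IH.
have : 0 <= (1 - r) * (1 - r ^+ d * r) by rewrite mulr_ge0 ?(ltW r10) // subr_ge0 mulr_ile1 // ltW.
by lra.
Qed.

Theorem theorem5p13 (R : realType) (alpha : R) (halpha : 0 <= alpha < 1) :
  exists c : R,
  forall (gT : finGroupType) (f : galg R[i] gT) (d : nat),
    gstar f = f -> spectrum_in alpha f -> (0 < d)%N ->
    exists2 delta : R,
      is_min (sos_shift (supp_upto alpha f d) f) delta &
      delta <=
        (if alpha == 0 then c / d%:R * sos_beta alpha f d
         else c / Num.sqrt (2 * d%:R - 1)
              * ((1 - alpha ^+ 2) / (1 + alpha ^+ 2)) ^+ d
              * sos_beta alpha f d).
Proof.
have /andP[a0 a1] := halpha.
have a10 : 0 < 1 - alpha by rewrite subr_gt0.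
have a20 : 0 <= alpha ^+ 2 by rewrite sqr_ge0.
(* The ratio of 1 - alpha to (1 - alpha^2) / (1 + alpha^2), less than 1 when
   alpha > 0. *)
pose r := (1 + alpha ^+ 2) / (1 + alpha).
pose c : R := if alpha == 0 then 1 else 2 / (1 - r).
suff err d : (0 < d)%N -> sqrt_err alpha (best_sqrt_approx alpha d) <=
    if alpha == 0 then c / d%:R
    else c / Num.sqrt (2 * d%:R - 1)
              * ((1 - alpha ^+ 2) / (1 + alpha ^+ 2)) ^+ d.
  exists c => gT f d sf spf d0.
  have [delta Hmin [b0 le_d]] := sos_shift_min_le halpha sf spf d0.
  exists delta => //; apply: le_trans le_d _.
  by have := err d d0; case: ifP => _ /ler_wpM2r; apply.
move=> d0; have [_ best] := best_sqrt_approxP halpha d.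
rewrite /c; have [alpha0|alpha0] := eqVneq alpha 0.
  have [q sq qE] := sqrt_approx_inverse R d0.
  apply: le_trans (best q sq) _; apply: sqrt_err_le => // t tI.
  have t01 : 0 <= t <= 1 by rewrite -[0]alpha0.
  by rewrite div1r; exact: qE.
have [q sq qE] := sqrt_approx_geometric d a0.
apply: le_trans (best q sq) _; apply: sqrt_err_le => // t tI.
apply: le_trans (qE t tI) _.
have alpha_gt0 : 0 < alpha by rewrite lt_def alpha0.
have r1 : r < 1 by rewrite ltr_pdivrMr ?mul1r ?ltrD2l; [rewrite expr2; nra | lra].
have r0 : 0 <= r by rewrite divr_ge0 // addr_ge0.
have -> : 1 - alpha = r * ((1 - alpha ^+ 2) / (1 + alpha ^+ 2)).
  rewrite /r; field.
  by rewrite !gt_eqF // ltr_wpDr.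
rewrite exprMn; apply: ler_wpM2r.
  rewrite exprn_ge0 // divr_ge0 //; last by lra.
  by rewrite subr_ge0 exprn_ile1 // ltW.
have d1 : 1 <= d%:R :> R by rewrite ler1n.
have s0 : 0 < Num.sqrt (2 * d%:R - 1) :> R by rewrite sqrtr_gt0; lra.
rewrite ler_pdivlMr //.
have s2 : Num.sqrt (2 * d%:R - 1) <= 2 * d%:R :> R.
  rewrite -[leRHS]ger0_norm ?mulr_ge0 // -sqrtr_sqr ler_wsqrtr //; nra.
rewrite (le_trans (ler_wpM2l _ s2)) ?exprn_ge0 //.
rewrite mulrC -mulrA ler_pM2l ?ltr0n //; exact: geometric_decay.
Qed.
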